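(* Let $l,m,n$ be positive integers such that $2\le m\le n$, $l\mid n$ and $l\le \min\{m-1,\frac n2\}$. Let $m\equiv s \pmod l$ with $0\le s<l$, and put $t=\frac{m-s}{l}$ and $k=\frac nl$. Let $I_{m,l}(C_n)\subseteq R=K[x_1,\dots,x_n]$ be the path ideal of the cycle $C_n$, i.e. the facet ideal of the path complex $\Delta_{m,l}(C_n)=\langle F_1,\dots,F_k\rangle$ with standard labeling. Write $k=p(t+1)+d$ with integers $p\ge 0$ and $0\le d\le t$. Then: (1) The projective dimension of $R/I_{m,l}(C_n)$ is $$\mathrm{pd}(R/I_{m,l}(C_n))=\begin{cases}2p, & \text{if } d=0,\\ 2p+1, & \text{if } d\ne 0.\end{cases}$$ (2) The regularity of $R/I_{m,l}(C_n)$ is $$\mathrm{reg}(R/I_{m,l}(C_n))=\begin{cases}n-2p, & \text{if } d=0,\\ n-2p-1, & \text{if } d\neq 0.\end{cases}$$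
   Context: $K$ is an arbitrary field and $R=K[x_1,\dots,x_n]$ with the standard grading. Indices of variables are read modulo $n$: $x_j=x_i$ whenever $j\equiv i \pmod n$, $1\le i\le n$. The path complex $\Delta_{m,l}(C_n)=\langle F_1,\dots,F_k\rangle$ of the $n$-cycle $C_n$ with standard labeling is the simplicial complex on $V=\{x_1,\dots,x_n\}$ with facets $F_i=\{x_{(i-1)l+1},\dots,x_{(i-1)l+m}\}$, $i=1,\dots,k$. The path ideal is its facet ideal $$I_{m,l}(C_n)=\Big(\prod_{j=1}^m x_{(i-1)l+j} : 1\le i\le k\Big).$$ With $\beta_{i,j}$ the graded Betti numbers of $R/I$ (the number of copies of $R(-j)$ in homological degree $i$ of the minimal graded free resolution of $R/I$), $\mathrm{pd}(R/I)=\max\{i : \beta_{i,j}\ne 0 \text{ for some } j\}$ and $\mathrm{reg}(R/I)=\max\{j-i : \beta_{i,j}\neq 0\}$. *)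

(* Defs.v *)
From HB Require Import structures.
From mathcomp Require Import all_boot all_order all_algebra.
From mathcomp Require Import mpoly.

Set Implicit Arguments.
Unset Strict Implicit.
Unset Printing Implicit Defensive.

Import GRing.Theory.
Local Open Scope ring_scope.

Definition is_max (disp : Order.disp_t) (T : orderType disp)
    (S : T -> Prop) (v : T) : Prop :=
  S v /\ forall w : T, S w -> (w <= v)%O.

Definition ideal_gen (K : fieldType) (n k : nat)
    (g : 'I_k -> {mpoly K[n]}) (f : {mpoly K[n]}) : Prop :=
  exists c : 'I_k -> {mpoly K[n]}, f = \sum_i c i * g i.

(* Indices are shifted by one: 'X_v stands for x_{v+1} and the value i < n/l
   for the facet F_{i+1} = {x_{il+1}, ..., x_{il+m}}, indices modulo n. *)
Definition path_facet (n m l i : nat) : {set 'I_n} :=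
  [set v : 'I_n | [exists j : 'I_m, (v : nat) == (i * l + j) %% n]%N].

Definition path_ideal (K : fieldType) (n m l : nat) : {mpoly K[n]} -> Prop :=
  ideal_gen
    (fun i : 'I_(n %/ l) => \prod_(v in path_facet n m l i) 'X_v).

(* The i-th module is the direct sum of the R(- gdeg i a), a < grank i; its
   elements are row vectors, and maps act by multiplication on the right.
   [gdiff i] is the differential from homological degree i.+1 to degree i;
   [gaug] followed by R -> R/I is the augmentation.
   Shifts are natural numbers because R/I lives in nonnegative degrees. *)
Record graded_free_seq (K : fieldType) (n : nat) := GradedFreeSeq {
  grank : nat -> nat;
  gdeg : forall i, 'I_(grank i) -> nat;
  gdiff : forall i, 'M[{mpoly K[n]}]_(grank i.+1, grank i);
  gaug : 'cV[{mpoly K[n]}]_(grank 0)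
}.

(* f is an entry of a degree-0 map R(-a) -> R(-b): it is homogeneous of degree
   a - b, hence zero when a < b. *)
Definition entry_homog (K : fieldType) (n a b : nat) (f : {mpoly K[n]}) : Prop :=
  {in msupp f, forall u : 'X_{1..n}, (b + mdeg u)%N = a}.

(* For an ideal I of R: F is a graded free resolution of R/I
   with d(F_{i+1}) contained in (x_1, ..., x_n) F_i for every i. *)
Record min_graded_free_resolution (K : fieldType) (n : nat)
    (I : {mpoly K[n]} -> Prop) (F : graded_free_seq K n) : Prop := {
  gaug_homog : forall a : 'I_(grank F 0),
    entry_homog (gdeg a) 0 (gaug F a 0);
  gdiff_homog : forall i (a : 'I_(grank F i.+1)) (b : 'I_(grank F i)),
    entry_homog (gdeg a) (gdeg b) (gdiff F i a b);
  gaug_surj : exists v : 'rV_(grank F 0), I (1 - (v *m gaug F) 0 0);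
  gaug_exact : forall v : 'rV_(grank F 0),
    I ((v *m gaug F) 0 0) <->
    exists w : 'rV_(grank F 1), v = w *m gdiff F 0;
  gdiff_exact : forall i (v : 'rV_(grank F i.+1)),
    v *m gdiff F i = 0 <->
    exists w : 'rV_(grank F i.+2), v = w *m gdiff F i.+1;
  gdiff_minimal : forall i (a : 'I_(grank F i.+1)) (b : 'I_(grank F i)),
    (gdiff F i a b)@_0%MM = 0
}.

(* Existence of a resolution and independence of its choice are both part of
   the definition. *)
Definition graded_betti (K : fieldType) (n : nat) (I : {mpoly K[n]} -> Prop)
    (beta : nat -> nat -> nat) : Prop :=
  (exists F, min_graded_free_resolution I F) /\
  (forall F, min_graded_free_resolution I F ->
   forall i j, beta i j = #|[set a : 'I_(grank F i) | gdeg a == j]|).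

(* pd (R/I) = v *)
Definition proj_dim_quot (K : fieldType) (n : nat) (I : {mpoly K[n]} -> Prop)
    (v : nat) : Prop :=
  exists2 beta, graded_betti I beta &
    is_max (fun i : nat => exists j, beta i j <> 0%N) v.

(* reg (R/I) = v *)
Definition regularity_quot (K : fieldType) (n : nat) (I : {mpoly K[n]} -> Prop)
    (v : int) : Prop :=
  exists2 beta, graded_betti I beta &
    is_max (fun r : int => exists i j, beta i j <> 0%N /\ r = j%:Z - i%:Z) v.

(* Main.v *)
Require Import Defs.
From HB Require Import structures.
From mathcomp Require Import all_boot all_order all_algebra.
From mathcomp Require Import zify ring.
From mathcomp Require Import mpoly.

Set Implicit Arguments.
Unset Strict Implicit.
Unset Printing Implicit Defensive.

Import GRing.Theory.
Local Open Scope ring_scope.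

(** The minimal free resolution of R/I is obtained by thinning out the Taylor
    resolution with discrete Morse theory.

    Let [k = n / l].  The Taylor complex of the [k] facet monomials has one cell
    for each set [S] of indices in Z/k, in homological degree [#|S|] and
    multidegree [L S], the union of the facets of [S].  All multidegrees are
    squarefree, so its differential is [c S S' * x^(L S - L S')] with [c S S']
    in [K], and a strand of monomials of support [W] only sees the scalars [c]
    on the cells with [L S] inside [W].  Exactness over R therefore amounts to
    exactness over [K] of these subcomplexes, for every [W] that contains a
    facet; this is [multigraded_exact].  Two cells of the same multidegree with
    [c S S'] nonzero can be cancelled by a Schur complement
    ([cancel_pair_exact]), hence so can all pairs of an acyclic matching
    ([cancel_matching]), and cancelling as long as possible ([minimize]) leaves
    a minimal resolution over R ([cell_resolution_min]).

    The facet [F_i] is determined, as far as unions are concerned, by the window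
    of blocks [i, ..., i + t - 1]: the last vertex of block [j] lies in [F_i]
    exactly when [j] is in the window ([last_vertexP]).  So [S] and [S + q] have
    the same multidegree when the neighbours of [q] in [S] are at distance at
    most [t] from each other.  The matching switches [0] when this is allowed;
    otherwise it goes around the cycle from the first element of [S] after [0],
    cuts it into blocks of length [t + 1] that start at elements [c] of [S], and
    switches [c + 1] in the first block where this is allowed.  A set that is
    left unmatched meets each block [c, ..., c + t] in [c] or in [c, c + 1], and
    in the first case the window of [c] misses the end of the block.  Hence a
    block holds at most two elements, and at least two if positions not covered
    by any window are counted with the elements.  Summing over the blocks
    ([critical_bounds]) gives, with [top] equal to [2 p] or [2 p + 1],

      [#|S| <= top <= #|S| + (number of uncovered positions)
                   <= #|S| + n - #|L S|].

    So every remaining cell, of homological degree [i] and degree [j], satisfies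
    [i <= top] and [j - i <= n - top].  Both bounds are attained by one cell of
    multidegree the whole vertex set ([top_set]).  It survives in the minimal
    resolution: by the bounds all unmatched sets of full multidegree have [top]
    elements, so there is nothing to cancel it with.

    That the Betti numbers do not depend on the resolution ([betti_unique]) is
    the comparison theorem: lifts of the identity between two minimal graded
    resolutions are mutually inverse modulo the variables. *)

(** * Uniqueness of graded Betti numbers *)

Section HomogeneousPart.
Variables (K : fieldType) (n : nat).
Implicit Types (p q : {mpoly K[n]}) (P Q : pred 'X_{1..n}).

Definition mono_part P p : {mpoly K[n]} :=
  \sum_(u <- msupp p | P u) p@_u *: 'X_[u].

Lemma mcoeff_mono_part P p u : (mono_part P p)@_u = if P u then p@_u else 0.
Proof.
rewrite /mono_part raddf_sum /=.
have -> : (if P u then p@_u else 0) =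
    if P u then (\sum_(w <- msupp p) p@_w *: 'X_[w])@_u else 0 by rewrite -mpolyE.
case: (boolP (P u)) => Pu.
  rewrite raddf_sum /= big_mkcond; apply: eq_bigr => w _; case: ifP => // Pw.
  rewrite mcoeffZ mcoeffX; case: eqP => [wu|_]; last by rewrite mulr0.
  by rewrite wu Pu in Pw.
rewrite big1 // => w Pw; rewrite mcoeffZ mcoeffX.
case: eqP => [wu|_]; last by rewrite mulr0.
by rewrite -wu Pw in Pu.
Qed.

Lemma mono_part_sum (I : finType) P (p : I -> {mpoly K[n]}) :
  mono_part P (\sum_i p i) = \sum_i mono_part P (p i).
Proof.
apply/mpolyP => u; rewrite mcoeff_mono_part !raddf_sum /=.
under [RHS]eq_bigr do rewrite mcoeff_mono_part.
by case: ifP => // _; rewrite big1.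
Qed.

(** Multiplication by [q] shifts the selection [P] to [Q]; for homogeneous [q]
    this makes taking homogeneous parts commute with graded maps. *)
Lemma mono_partM P Q p q :
    (forall u w, w \in msupp q -> Q (u + w)%MM = P u) ->
  mono_part Q (p * q) = mono_part P p * q.
Proof.
move=> PQ; apply/mpolyP => u; rewrite mcoeff_mono_part !mcoeffM.
under [RHS]eq_bigr do rewrite mcoeff_mono_part.
rewrite -[LHS]/(if Q u then _ else 0) (fun_if (fun x => x)).
case: (boolP (Q u)) => Qu.
  apply: eq_bigr => -[u1 u2] /= /eqP uE.
  have [q2|/memN_msupp_eq0->] := boolP ((u2 : 'X_{1..n}) \in msupp q).
    by rewrite -(PQ _ _ q2) -uE Qu.
  by rewrite !mulr0.
rewrite big1 // => -[u1 u2] /= /eqP uE.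
have [q2|/memN_msupp_eq0->] := boolP ((u2 : 'X_{1..n}) \in msupp q).
  by rewrite -(PQ _ _ q2) -uE (negPf Qu) mul0r.
by rewrite mulr0.
Qed.

End HomogeneousPart.

Definition homog_mx (K : fieldType) (n r s : nat) (e : 'I_r -> nat)
    (f : 'I_s -> nat) (M : 'M[{mpoly K[n]}]_(r, s)) : Prop :=
  forall a b, entry_homog (e a) (f b) (M a b).

Lemma homog_mx_mul (K : fieldType) (n r s q : nat) (e : 'I_r -> nat)
    (f : 'I_s -> nat) (g : 'I_q -> nat) (M : 'M[{mpoly K[n]}]_(r, s))
    (N : 'M[{mpoly K[n]}]_(s, q)) :
  homog_mx e f M -> homog_mx f g N -> homog_mx e g (M *m N).
Proof.
move=> hM hN a c u; rewrite mxE => /msupp_sum_le /flatten_mapP[b _].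
case/msuppM_le/allpairsP => -[u1 u2] /= [/hM h1 /hN h2 ->].
by rewrite mdegD -h1 -h2; lia.
Qed.

(** A lift of a homogeneous map through a homogeneous [D] can be chosen
    homogeneous: the homogeneous part of any lift is again a lift. *)
Lemma homog_lift (K : fieldType) (n r s q : nat) (e : 'I_r -> nat)
    (f : 'I_s -> nat) (g : 'I_q -> nat) (M : 'M[{mpoly K[n]}]_(r, q))
    (D : 'M[{mpoly K[n]}]_(s, q)) :
    homog_mx e g M -> homog_mx f g D ->
    (forall a, exists w : 'rV_s, row a M = w *m D) ->
  exists2 N : 'M_(r, s), homog_mx e f N & M = N *m D.
Proof.
move=> hM hD /fin_all_exists[w wE].
pose N := \matrix_(a, b) mono_part (fun u => (f b + mdeg u)%N == e a) (w a 0 b).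
exists N.
  move=> a b u; rewrite mxE mcoeff_msupp mcoeff_mono_part.
  by case: ifP => [/eqP-> //|_]; rewrite eqxx.
apply/matrixP => a c; have /rowP/(_ c) := wE a; rewrite !mxE => MacE.
transitivity (mono_part (fun u => (g c + mdeg u)%N == e a) (M a c)).
  apply/mpolyP => u; rewrite mcoeff_mono_part.
  have [/hM ->|/memN_msupp_eq0->] := boolP (u \in msupp (M a c)).
    by rewrite eqxx.
  by rewrite if_same.
rewrite MacE mono_part_sum; apply: eq_bigr => b _.
rewrite !mxE; apply: mono_partM => u v /hD <-; rewrite mdegD.
by congr (_ == _); lia.
Qed.

Definition const_terms (K : fieldType) (n r s : nat)
  (M : 'M[{mpoly K[n]}]_(r, s)) : 'M[K]_(r, s) := map_mx (mcoeff 0%MM) M.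

(** The last clause is the closure property of ideals spanned by monomials; it
    lets the augmentation of a resolution be lifted homogeneously. *)
Definition monomial_ideal (K : fieldType) (n : nat) (I : {mpoly K[n]} -> Prop) :=
  [/\ forall f g, I f -> I g -> I (f + g), forall f g, I g -> I (f * g)
    & forall P f, I f -> I (mono_part P f)].

(** The data carried by the inductive construction of comparison maps: [phi] and
    [psi] admit lifts to the next homological degree, and [h] is a homotopy from
    [phi *m psi] to the identity up to a map that vanishes on boundaries.
    Only [phi] and [psi] need to be homogeneous, since the homotopies vanish
    modulo the variables. *)
Definition comparable_at (K : fieldType) (n : nat) (F G : graded_free_seq K n)
    i : Prop :=
  exists (phi : 'M_(grank F i, grank G i)) (psi : 'M_(grank G i, grank F i))
     (h : 'M_(grank F i, grank F i.+1)),
  [/\ homog_mx (@gdeg _ _ F i) (@gdeg _ _ G i) phi /\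
      homog_mx (@gdeg _ _ G i) (@gdeg _ _ F i) psi,
      forall a, exists w : 'rV_(grank G i.+1),
        row a (gdiff F i *m phi) = w *m gdiff G i,
      forall a, exists w : 'rV_(grank F i.+1),
        row a (gdiff G i *m psi) = w *m gdiff F i,
      gdiff F i *m (phi *m psi - 1%:M - h *m gdiff F i) = 0
    & const_terms (phi *m psi) = 1%:M].

Lemma mulmx_rows (K : fieldType) (n r s q : nat) (M : 'M[{mpoly K[n]}]_(r, q))
    (D : 'M[{mpoly K[n]}]_(s, q)) :
  (forall a, exists w : 'rV_s, row a M = w *m D) -> exists N, M = N *m D.
Proof.
move=> /fin_all_exists[w wE]; exists (\matrix_a w a).
by apply/row_matrixP => a; rewrite row_mul rowK wE.
Qed.

Lemma const_termsM (K : fieldType) (n r s q : nat) (M : 'M[{mpoly K[n]}]_(r, s))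
    (N : 'M[{mpoly K[n]}]_(s, q)) :
  const_terms (M *m N) = const_terms M *m const_terms N.
Proof. exact: map_mxM. Qed.

Lemma const_termsD (K : fieldType) (n r s : nat) (M N : 'M[{mpoly K[n]}]_(r, s)) :
  const_terms (M + N) = const_terms M + const_terms N.
Proof. exact: map_mxD. Qed.

Lemma const_terms1 (K : fieldType) (n r : nat) :
  const_terms (1%:M : 'M[{mpoly K[n]}]_r) = 1%:M.
Proof. exact: map_mx1. Qed.

Section Comparison.
Variables (K : fieldType) (n : nat) (I : {mpoly K[n]} -> Prop).
Hypothesis idealI : monomial_ideal I.

Let idealD f g : I f -> I g -> I (f + g).
Proof. by case: idealI => H _ _; exact: H. Qed.
Let idealM f g : I g -> I (f * g).
Proof. by case: idealI => _ H _; exact: H. Qed.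
Let idealP P f : I f -> I (mono_part P f).
Proof. by case: idealI => _ _ H; exact: H. Qed.

Let ideal_sum (J : finType) (f : J -> {mpoly K[n]}) g :
  I g -> (forall j, I (f j)) -> I (\sum_j f j).
Proof. by move=> /(idealM 0); rewrite mul0r => I0 If; elim/big_ind: _. Qed.

(** The generators of [F] are sent to multiples of a representative of [1] in
    [G], whose degree-zero part is again a representative of [1]. *)
Lemma aug_lift (F G : graded_free_seq K n) :
    min_graded_free_resolution I F -> min_graded_free_resolution I G ->
  exists2 phi : 'M_(grank F 0, grank G 0),
    homog_mx (@gdeg _ _ F 0) (@gdeg _ _ G 0) phi
  & forall a, I ((phi *m gaug G - gaug F) a 0).
Proof.
move=> resF resG; have [v Iv] := gaug_surj resG.
pose v0 b := mono_part (fun u => (gdeg b + mdeg u)%N == 0%N) (v 0 b).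
exists (\matrix_(a, b) (gaug F a 0 * v0 b)).
  move=> a b u; rewrite mxE => /msuppM_le/allpairsP[[u1 u2] /= [u1F]].
  rewrite mcoeff_msupp mcoeff_mono_part; case: ifP => [/eqP u2E _ ->|]; last first.
    by rewrite eqxx.
  by rewrite mdegD -(gaug_homog resF u1F) add0n addnCA u2E addn0.
have Iv0 : I (1 - \sum_b v0 b * gaug G b 0).
  have := idealP (fun u => mdeg u == 0%N) Iv; congr (I _).
  have -> : forall P (f g : {mpoly K[n]}),
      mono_part P (f - g) = mono_part P f - mono_part P g.
    move=> P f g; apply/mpolyP => u; rewrite mcoeffB !mcoeff_mono_part mcoeffB.
    by case: ifP => //; rewrite subr0.
  congr (_ - _).
    apply/mpolyP => u; rewrite mcoeff_mono_part mcoeff1 mdeg_eq0.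
    by case: eqP => // ->.
  rewrite mxE mono_part_sum; apply: eq_bigr => b _; apply: mono_partM.
  by move=> u w /(gaug_homog resG) <-; rewrite mdegD add0n addnC.
move=> a; have := idealM (- gaug F a 0) Iv0; congr (I _).
rewrite !mxE mulNr mulrBr mulr1 opprB mulr_sumr; congr (_ - _).
by apply: eq_bigr => b _; rewrite mxE mulrA.
Qed.

Lemma aug_lift_rows (F G : graded_free_seq K n) phi :
    min_graded_free_resolution I F -> min_graded_free_resolution I G ->
    (forall a, I ((phi *m gaug G - gaug F) a 0)) ->
  forall a, exists w : 'rV_(grank G 1),
    row a (gdiff F 0 *m phi) = w *m gdiff G 0.
Proof.
move=> resF resG Iphi a; apply/(gaug_exact resG).
have IF : I ((row a (gdiff F 0) *m gaug F) 0 0).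
  by apply/(gaug_exact resF); exists (delta_mx 0 a); rewrite rowE.
rewrite row_mul -mulmxA -[phi *m _](subrK (gaug F)) mulmxDr mxE; apply: idealD => //.
by rewrite mxE; apply: (ideal_sum IF) => b; apply/idealM/Iphi.
Qed.

Variables (F G : graded_free_seq K n).
Hypothesis resF : min_graded_free_resolution I F.
Hypothesis resG : min_graded_free_resolution I G.

Let diff0 (H : graded_free_seq K n) i : min_graded_free_resolution I H ->
  gdiff H i.+1 *m gdiff H i = 0.
Proof.
move=> resH; apply/row_matrixP => a; rewrite row_mul row0.
by apply/(gdiff_exact resH); exists (delta_mx 0 a); rewrite rowE.
Qed.

Let const_diff i : const_terms (gdiff F i) = 0.
Proof. by apply/matrixP => a b; rewrite !mxE (gdiff_minimal resF). Qed.

(** With [phi'] and [psi'] the lifts of [phi] and [psi], the map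
    [phi' *m psi' - 1 - d *m h] is killed by [d], hence factors through the next
    differential; that factor is the next homotopy.  Minimality makes both
    [d *m h] and [h' *m d'] vanish modulo the variables. *)
Lemma comparable i : comparable_at F G i.
Proof.
elim: i => [|i [phi [psi [h [[hphi hpsi] phi1 psi1 hE _]]]]].
  have [phi hphi phiE] := aug_lift resF resG.
  have [psi hpsi psiE] := aug_lift resG resF.
  have : forall a, exists w : 'rV_(grank F 1),
      row a (phi *m psi - 1%:M) = w *m gdiff F 0.
    move=> a; apply/(gaug_exact resF).
    have -> : row a (phi *m psi - 1%:M) *m gaug F =
       row a phi *m (psi *m gaug F - gaug G) + row a (phi *m gaug G - gaug F).
      rewrite -!row_mul mulmxBl mul1mx mulmxBr -mulmxA -[RHS]linearD /=.
      by rewrite addrA subrK.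
    rewrite mxE [X in _ + X]mxE; apply: idealD => //.
    by rewrite mxE; apply: (ideal_sum (phiE a)) => b; apply/idealM/psiE.
  case/mulmx_rows => h hE; exists phi, psi, h; split=> //.
  - exact: aug_lift_rows.
  - exact: aug_lift_rows.
  - by rewrite hE subrr mulmx0.
  - rewrite -[phi *m psi](subrK 1%:M) hE const_termsD const_termsM const_diff.
    by rewrite mulmx0 add0r const_terms1.
have [phi' hphi' phiE] := homog_lift
  (homog_mx_mul (@gdiff_homog _ _ _ _ resF i) hphi) (@gdiff_homog _ _ _ _ resG i) phi1.
have [psi' hpsi' psiE] := homog_lift
  (homog_mx_mul (@gdiff_homog _ _ _ _ resG i) hpsi) (@gdiff_homog _ _ _ _ resF i) psi1.
have : forall a, exists w : 'rV_(grank F i.+2),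
    row a (phi' *m psi' - 1%:M - gdiff F i *m h) = w *m gdiff F i.+1.
  move=> a; apply/(gdiff_exact resF); rewrite -row_mul.
  rewrite !mulmxBl mul1mx -mulmxA -psiE [phi' *m _]mulmxA -phiE -!mulmxA.
  move: hE; rewrite !mulmxBr mulmx1 => ->; exact: row0.
case/mulmx_rows => h' h'E; exists phi', psi', h'; split=> //.
- move=> a; apply/(gdiff_exact resG).
  by rewrite -row_mul -mulmxA -phiE mulmxA diff0 // mul0mx row0.
- move=> a; apply/(gdiff_exact resF).
  by rewrite -row_mul -mulmxA -psiE mulmxA diff0 // mul0mx row0.
- rewrite -h'E [X in _ *m X](_ : _ = gdiff F i *m h); last first.
    by rewrite opprB addrC subrK.
  by rewrite mulmxA diff0 // mul0mx.
- have -> : phi' *m psi' = h' *m gdiff F i.+1 + gdiff F i *m h + 1%:M.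
    by rewrite -h'E !subrK.
  by rewrite !const_termsD !const_termsM !const_diff mulmx0 mul0mx !add0r const_terms1.
Qed.

(** Modulo the variables a homogeneous [phi] only relates generators of equal
    degree, so [phi *m psi = 1] restricts to generators of degree [j], where it
    compares the two counts. *)
Lemma betti_le i j :
  (#|[set a : 'I_(grank F i) | gdeg a == j]| <=
   #|[set a : 'I_(grank G i) | gdeg a == j]|)%N.
Proof.
have [phi [psi [_ [[hphi hpsi] _ _ _ c1]]]] := comparable i.
set A := [set a : 'I_(grank F i) | _]; set B := [set b : 'I_(grank G i) | _].
pose X := \matrix_(a < #|A|, b < #|B|) const_terms phi (enum_val a) (enum_val b).
pose Y := \matrix_(b < #|B|, a < #|A|) const_terms psi (enum_val b) (enum_val a).
suff XY : X *m Y = 1%:M by apply: (mulmx1_min XY).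
apply/matrixP => a a'; move/matrixP: c1 => /(_ (enum_val a) (enum_val a')).
rewrite const_termsM !mxE (inj_eq enum_val_inj) => <-.
rewrite [RHS](bigID (mem B)) /= [X in _ = _ + X]big1 ?addr0 => [|b bNB].
  by rewrite [RHS]big_enum_val; apply: eq_bigr => b _; rewrite !mxE.
rewrite !mxE; have [/hphi|/memN_msupp_eq0->] :=
  boolP (0%MM \in msupp (phi (enum_val a) b)); last by rewrite mul0r.
move: (enum_valP a); rewrite inE => /eqP -> bj; move: bNB.
by rewrite inE -bj mdeg0 addn0 eqxx.
Qed.

End Comparison.

Lemma betti_unique (K : fieldType) (n : nat) (I : {mpoly K[n]} -> Prop)
    (F G : graded_free_seq K n) i j :
    monomial_ideal I ->
    min_graded_free_resolution I F -> min_graded_free_resolution I G ->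
  #|[set a : 'I_(grank F i) | gdeg a == j]| =
  #|[set a : 'I_(grank G i) | gdeg a == j]|.
Proof.
by move=> idealI rF rG; apply/eqP; rewrite eqn_leq !(betti_le idealI).
Qed.

(** * Cancelling cells of equal multidegree *)

Section Cancellation.
Variables (K : fieldType) (T : finType) (n : nat).
Variables (hd : T -> nat) (L : T -> {set 'I_n}) (good : {set 'I_n} -> Prop).
Implicit Types (A : {set T}) (c : T -> T -> K) (v w : T -> K) (W : {set 'I_n}).

(** The differential with coefficients [c], acting on row vectors. *)
Definition act c v y : K := \sum_x v x * c x y.

Definition supported A W v : Prop :=
  forall x, v x != 0 -> x \in A /\ L x \subset W.

(** [A] is the set of cells and [c] the matrix of the differential.  [hd] is the
    homological degree, [L] the multidegree, and [good W] says that the strand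
    of monomials of support [W] has no homology at all, in other words that
    these monomials lie in the ideal. *)
Record multigraded_exact A c : Prop := {
  mg_supp : forall x y, c x y != 0 ->
    [/\ x \in A, y \in A, hd x = (hd y).+1 & L y \subset L x];
  mg_sq : forall x z, act c (c x) z = 0;
  mg_exact : forall W, good W -> forall v, supported A W v ->
    (forall y, act c v y = 0) ->
    exists2 w, supported A W w & forall y, v y = act c w y
}.

(** The Schur complement of the pivot [c a b], with the rows and columns of both
    cells erased. *)
Definition cancel_pair c a b x y : K :=
  if (x \in [set a; b]) || (y \in [set a; b]) then 0
  else c x y - c x b / c a b * c a y.

Lemma act_lin c v w (k : K) y :
  act c (fun x => v x + k * w x) y = act c v y + k * act c w y.
Proof.
rewrite /act mulr_sumr -big_split; apply: eq_bigr => x _.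
by rewrite /= mulrDl mulrA.
Qed.

Lemma act_delta c a y : act c (fun x => (x == a)%:R) y = c a y.
Proof.
rewrite /act (bigD1 a) //= eqxx mul1r big1 ?addr0 // => x /negPf->.
by rewrite mul0r.
Qed.

Section CancelPair.
Variables (A : {set T}) (c : T -> T -> K) (a b : T).
Hypothesis cA : multigraded_exact A c.
Hypothesis cab : c a b != 0.
Hypothesis Lab : L a = L b.

Let c' := cancel_pair c a b.
Let A' := A :\ a :\ b.

Let aA : a \in A. Proof. by case: (mg_supp cA cab). Qed.
Let bA : b \in A. Proof. by case: (mg_supp cA cab). Qed.
Let hab : hd a = (hd b).+1. Proof. by case: (mg_supp cA cab). Qed.
Let aNb : (a == b) = false.
Proof. by apply/eqP => ab; move: hab; rewrite ab => /n_Sn. Qed.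

Let c0 x y : hd x <> (hd y).+1 -> c x y = 0.
Proof. by move=> h; apply/eqP; apply: contra_notT h => /(mg_supp cA)[]. Qed.

Let g x y := c x y - c x b / c a b * c a y.

Let g_b x : g x b = 0. Proof. by rewrite /g divfK ?subrr. Qed.
Let g_a y : g a y = 0. Proof. by rewrite /g divff ?mul1r ?subrr. Qed.

Let c'E x y : x \notin [set a; b] -> y \notin [set a; b] -> c' x y = g x y.
Proof. by rewrite /c' /cancel_pair => /negPf-> /negPf->. Qed.

Let act_g v y : act g v y = act c v y - act c v b / c a b * c a y.
Proof.
rewrite /act !mulr_suml -sumrB; apply: eq_bigr => x _.
by rewrite /g mulrBr !mulrA.
Qed.

Let act_c' v y : v b = 0 -> y \notin [set a; b] -> act c' v y = act g v y.
Proof.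
move=> vb yN; apply: eq_bigr => x _.
have [->|xb] := eqVneq x b; first by rewrite vb !mul0r.
have [->|xa] := eqVneq x a.
  by rewrite g_a /c' /cancel_pair !inE eqxx.
by rewrite c'E // !inE negb_or xa.
Qed.

(** Subtracting multiples of row [a] clears column [b]; row [a] then splits off
    an acyclic complex with basis [a] and its boundary.  As [L a = L b] the
    multiples involved stay within each [W]. *)
Lemma cancel_pair_exact : multigraded_exact A' c'.
Proof.
split.
- move=> x y; rewrite /c' /cancel_pair; case: ifP => [_|]; first by rewrite eqxx.
  move/norP => [xN yN] nz.
  have [xA yA hx hL] : [/\ x \in A, y \in A, hd x = (hd y).+1 & L y \subset L x].
    have [cxy|/(mg_supp cA)//] := eqVneq (c x y) 0.
    move: nz; rewrite cxy sub0r oppr_eq0 mulf_eq0 negb_or mulf_eq0 negb_or.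
    case/andP => /andP[/(mg_supp cA)[-> _ hxb Lbx] _] /(mg_supp cA)[_ -> hay Lya].
    split=> //; first by rewrite hxb -hab.
    by apply: subset_trans Lya _; rewrite Lab.
  move: xN yN; rewrite !inE !negb_or => /andP[-> ->] /andP[-> ->].
  by rewrite xA yA.
- move=> x z; have [xN|xN] := boolP (x \in [set a; b]).
    by rewrite /act big1 // => y _; rewrite /c' /cancel_pair xN mul0r.
  have [zN|zN] := boolP (z \in [set a; b]).
    by rewrite /act big1 // => y _; rewrite /c' /cancel_pair zN orbT mulr0.
  have gsq y : act g (c y) z = 0 by rewrite act_g !(mg_sq cA) mul0r mul0r subr0.
  transitivity (act g (g x) z).
    apply: eq_bigr => y _; have [yN|yN] := boolP (y \in [set a; b]).
      rewrite {1 2}/c' /cancel_pair yN !orbT mul0r.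
      by case/set2P: yN => ->; rewrite ?g_a ?g_b ?mulr0 ?mul0r.
    by rewrite !c'E.
  have -> : act g (g x) z = act g (fun y => c x y + - (c x b / c a b) * c a y) z.
    by apply: eq_bigr => y _; rewrite /g mulNr.
  by rewrite act_lin !gsq mulr0 addr0.
- move=> W goodW v vA' vc'.
  have vA x : v x != 0 -> x \in A by case/vA'; rewrite !inE => /and3P[].
  have va : v a = 0.
    by apply/eqP; apply: contraT => /vA'[]; rewrite !inE eqxx andbF.
  have vb : v b = 0.
    by apply/eqP; apply: contraT => /vA'[]; rewrite !inE eqxx.
  (* correct v along a so that its boundary no longer meets b *)
  pose al := - (act c v b / c a b).
  pose v2 x := v x + al * (x == a)%:R.
  have act_v2 y : act c v2 y = act g v y.
    by rewrite act_lin act_delta act_g mulNr.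
  have v2g y : y != a -> act c v2 y = 0.
    move=> ya; rewrite act_v2; have [->|yb] := eqVneq y b.
      by rewrite /act big1 // => x _; rewrite g_b mulr0.
    by rewrite -act_c' ?vc' // !inE negb_or ya.
  have v2c y : act c v2 y = 0.
    have [->|/v2g//] := eqVneq y a.
    have : act c (act c v2) b = 0.
      rewrite /act; under eq_bigr do rewrite mulr_suml.
      rewrite exchange_big big1 // => x _.
      under eq_bigr do rewrite -mulrA.
      by rewrite -mulr_sumr -/(act c (c x) b) (mg_sq cA) mulr0.
    rewrite {1}/act (bigD1 a) //= big1 ?addr0 => [|x xa]; last by rewrite v2g ?mul0r.
    by move/eqP; rewrite mulf_eq0 (negPf cab) orbF => /eqP.
  have LWb : al != 0 -> L b \subset W.
    rewrite oppr_eq0 mulf_eq0 negb_or => /andP[+ _]; apply: contraNT => LbW.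
    rewrite /act big1 // => x _; have [->|/vA'[_ LxW]] := eqVneq (v x) 0.
      by rewrite mul0r.
    rewrite [c x b](_ : _ = 0) ?mulr0 //; apply/eqP; apply: contraNT LbW.
    by case/(mg_supp cA) => _ _ _ /subset_trans; apply.
  have v2A : supported A W v2.
    move=> x; rewrite /v2; have [->|xa] := eqVneq x a.
      by rewrite va add0r mulr1 Lab => /LWb; split.
    by rewrite mulr0 addr0 => vx; split; [exact: vA | case/vA': vx].
  have [w wA wE] := mg_exact cA goodW v2A v2c.
  (* w is only defined up to boundaries: use that of a to remove its b-component *)
  pose w2 x := w x + - (w b / c a b) * c a x.
  have w2b : w2 b = 0 by rewrite /w2 mulNr divfK ?subrr.
  pose w3 x := if x == a then 0 else w2 x.
  have w3b : w3 b = 0 by rewrite /w3 w2b if_same.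
  exists w3.
    move=> x; rewrite /w3; have [_|xa] := eqVneq x a; first by rewrite eqxx.
    have [->|xb] := eqVneq x b; first by rewrite w2b eqxx.
    rewrite !inE xa xb /= /w2; have [->|/wA//] := eqVneq (w x) 0.
    rewrite add0r mulf_eq0 negb_or oppr_eq0 mulf_eq0 negb_or.
    case/andP => /andP[/wA[_ LbW] _] /(mg_supp cA)[_ -> _ Lxa]; split=> //.
    by apply: subset_trans Lxa _; rewrite Lab.
  move=> y; have [yab|yN] := boolP (y \in [set a; b]).
    transitivity (0 : K); first by case/set2P: yab => ->.
    by rewrite /act big1 // => x _; rewrite /c' /cancel_pair yab orbT mulr0.
  rewrite act_c' //; transitivity (act g w2 y); last first.
    apply: eq_bigr => x _; rewrite /w3; case: eqP => // ->.
    by rewrite g_a !mulr0.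
  have act_w2 z : act c w2 z = v2 z by rewrite act_lin (mg_sq cA) mulr0 addr0 -wE.
  rewrite act_g !act_w2 /v2 vb [b == a]eq_sym aNb mulr0 addr0 !mul0r subr0.
  by move: yN; rewrite !inE negb_or => /andP[/negPf-> _]; rewrite mulr0 addr0.
Qed.

End CancelPair.

(** Algebraic discrete Morse theory.  The pair [(u, mate u)] of least rank is
    cancelled first: no other upper cell has [mate u] in its boundary, so the
    coefficients between the remaining matched cells do not change and the
    induction goes on. *)
Lemma cancel_matching (A U : {set T}) c (mate : T -> T) (rank : T -> nat) :
    multigraded_exact A c -> {in U &, injective mate} ->
    (forall u, u \in U ->
       [/\ mate u \notin U, L (mate u) = L u & c u (mate u) != 0]) ->
    (forall u u', u \in U -> u' \in U -> u' != u -> c u' (mate u) != 0 ->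
       (rank u' < rank u)%N) ->
  exists c', multigraded_exact (A :\: (U :|: mate @: U)) c'.
Proof.
elim: {U}_.+1 {-2}U (ltnSn #|U|) => // N IH U ltUN in A c *.
move=> cA mate_inj mateP rankP.
have [->|[u0 u0U]] := set_0Vmem U.
  by exists c; rewrite imset0 setU0 setD0.
case: (arg_minnP rank u0U) => u; rewrite -/(u \in U) => uU umin.
have [uN Lu cu] := mateP u uU.
have mN u1 : u1 \in U -> u1 != u -> c u1 (mate u) = 0.
  move=> u1U u1u; apply/eqP; apply: contraTT (umin _ u1U) => nz.
  by rewrite -ltnNge; apply: rankP.
have eq_c u1 u2 : u1 \in U :\ u -> u2 \in U :\ u ->
    cancel_pair c u (mate u) u1 (mate u2) = c u1 (mate u2).
  rewrite !inE => /andP[u1u u1U] /andP[u2u u2U]; rewrite /cancel_pair mN //.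
  rewrite !inE (negPf u1u) (inj_in_eq mate_inj) // (negPf u2u).
  have [m2N _ _] := mateP _ u2U.
  have -> : (u1 == mate u) = false by apply: contraNF uN => /eqP<-.
  have -> : (mate u2 == u) = false by apply: contraNF m2N => /eqP->.
  by rewrite !mul0r subr0.
have ltUuN : (#|U :\ u| < N)%N.
  by rewrite -ltnS; apply: leq_trans ltUN; rewrite ltnS (cardsD1 u U) uU.
have [||||c' c'A] :=
  IH (U :\ u) ltUuN (A :\ u :\ mate u) (cancel_pair c u (mate u)).
- exact: cancel_pair_exact.
- by move=> x y; rewrite !inE => /andP[_ xU] /andP[_ yU]; apply: mate_inj.
- move=> u1 u1U; rewrite eq_c //; move: u1U; rewrite !inE => /andP[_ /mateP[mU L1 c1]].
  by rewrite (negPf mU) andbF.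
- move=> u1 u2 u1U u2U; rewrite eq_c //; move: u1U u2U; rewrite !inE.
  by case/andP => _ u1U /andP[_ u2U]; apply: rankP.
- exists c'; move: c'A; congr multigraded_exact; apply/setP => x.
  rewrite !inE -{3 4}(setD1K uU) imsetU1 !inE.
  by case: (x == u); case: (x == mate u); case: (x \in mate @: _);
    rewrite ?andbF ?andbT ?orbT //=.
Qed.

(** Cancel until no coefficient joins two cells of the same multidegree.  A cell
    is never cancelled if all the cells of its multidegree have its homological
    degree, as a cancelled pair has consecutive degrees. *)
Lemma minimize A c : multigraded_exact A c ->
  exists A' c', [/\ A' \subset A, multigraded_exact A' c',
    forall x y, c' x y != 0 -> L x != L y
  & forall x, x \in A -> (forall y, y \in A -> L y = L x -> hd y = hd x) ->
      x \in A'].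
Proof.
elim: {A}_.+1 {-2}A (ltnSn #|A|) => // N IH A ltAN in c *.
move=> cA.
have [|noab] := boolP [exists a, [exists b, (c a b != 0) && (L a == L b)]]; last first.
  exists A, c; split=> // x y cxy; apply: contra noab => Lxy.
  by apply/existsP; exists x; apply/existsP; exists y; rewrite cxy.
case/existsP => a /existsP[b /andP[cab /eqP Lab]].
have [aA bA hab _] := mg_supp cA cab.
have sub : A :\ a :\ b \subset A by apply: subset_trans (subD1set _ _) (subD1set _ _).
have [|A' [c' [A'A c'A' min keep]]] := IH _ _ _ (cancel_pair_exact cA cab Lab).
  rewrite -ltnS; apply: leq_trans ltAN; rewrite ltnS (cardsD1 a A) aA.
  by rewrite ltnS; apply/subset_leq_card/subD1set.
exists A', c'; split=> //; first exact: subset_trans sub.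
move=> x xA xP; apply: keep => [|y yA]; last by apply: xP; apply: (subsetP sub).
rewrite !inE xA andbT; apply/andP; split; apply/eqP => xE.
  by move: (xP a aA); rewrite xE hab => /(_ Lab) /esym/n_Sn.
by move: (xP b bA); rewrite xE hab => /(_ (esym Lab)) /n_Sn.
Qed.

End Cancellation.

(** * The Taylor complex *)

Section Taylor.
Variables (K : fieldType) (k n : nat) (F : 'I_k -> {set 'I_n}).
Implicit Types (x y z S : {set 'I_k}) (i j : 'I_k).

Definition facet_union S : {set 'I_n} := \bigcup_(i in S) F i.

Definition insert_sign y i : K := (-1) ^+ #|[set j in y | (j < i)%N]|.

Definition taylor_coef x y : K :=
  \sum_(i | i \notin y) (x == i |: y)%:R * insert_sign y i.

Lemma sum_antisym (f : 'I_k -> 'I_k -> K) :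
    (forall i, f i i = 0) -> (forall i j, i != j -> f i j = - f j i) ->
  \sum_i \sum_j f i j = 0.
Proof.
move=> fii fij.
have split_lt i : \sum_j f i j =
    \sum_(j : 'I_k | (i < j)%N) f i j - \sum_(j : 'I_k | (j < i)%N) f j i.
  rewrite (bigID (fun j : 'I_k => (i < j)%N)) /=; congr (_ + _).
  rewrite (bigD1 i) ?ltnn //= fii add0r -sumrN; apply: eq_big => j.
    by rewrite -leqNgt ltn_neqAle andbC.
  by case/andP=> _ ji; rewrite fij // eq_sym.
under eq_bigr do rewrite split_lt; rewrite sumrB.
rewrite [X in X - _](exchange_big_dep xpredT) //=.
by rewrite subrr.
Qed.

Lemma insert_signU y i j : i \notin y ->
  insert_sign (i |: y) j = (-1) ^+ (i < j)%N * insert_sign y j.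
Proof.
move=> iy; rewrite /insert_sign -exprD; congr (_ ^+ _).
have [ij|ij] := ltnP i j; last first.
  rewrite add0n; apply: eq_card => u; rewrite !inE.
  by case: eqP => // ->; rewrite ltnNge ij !andbF.
transitivity #|i |: [set u in y | (u < j)%N]|.
  by apply: eq_card => u; rewrite !inE; case: eqP => // ->; rewrite ij.
by rewrite cardsU1 inE (negPf iy).
Qed.

Lemma insert_sign_sq y i : insert_sign y i * insert_sign y i = 1.
Proof. by rewrite -expr2 sqrr_sign. Qed.

(** This antisymmetry makes the differential square to zero and the homotopy of
    [taylor_exact] work. *)
Lemma insert_sign_swap y i j : i \notin y -> j \notin y -> i != j ->
  insert_sign y i * insert_sign (i |: y) j =
  - (insert_sign y j * insert_sign (j |: y) i).
Proof.
move=> iy jy; rewrite !insert_signU // neq_ltn => /orP[] ij; rewrite ij.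
  by rewrite [(j < i)%N]ltnNge ltnW //= expr1 expr0 mul1r mulN1r mulrN mulrC.
by rewrite [(i < j)%N]ltnNge ltnW //= expr1 expr0 mul1r mulN1r mulrN opprK mulrC.
Qed.

Lemma act_taylor v y : act taylor_coef v y =
  \sum_(i | i \notin y) insert_sign y i * v (i |: y).
Proof.
rewrite /act; under eq_bigr do rewrite /taylor_coef mulr_sumr.
rewrite exchange_big; apply: eq_bigr => i _ /=.
rewrite (bigD1 (i |: y)) //= eqxx mul1r big1 ?addr0 1?mulrC // => x /negPf->.
by rewrite mul0r mulr0.
Qed.

Lemma taylor_coef_neq0 x y : taylor_coef x y != 0 ->
  exists2 i, i \notin y & x = i |: y.
Proof.
move=> nz; have [/existsP[i /andP[iy /eqP->]]|no] :=
  boolP [exists i, (i \notin y) && (x == i |: y)]; first by exists i.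
case/eqP: nz; rewrite /taylor_coef big1 // => i iy.
suff -> : (x == i |: y) = false by rewrite mul0r.
by apply: contraNF no => xE; apply/existsP; exists i; rewrite iy.
Qed.

Lemma taylor_coef_insert i y : i \notin y -> taylor_coef (i |: y) y = insert_sign y i.
Proof.
move=> iy; rewrite /taylor_coef (bigD1 i) //= eqxx mul1r big1 ?addr0 // => j.
case/andP => jy ji; case: eqP => [E|_]; last by rewrite mul0r.
have := setU11 j y; rewrite -E !inE (negPf jy) orbF => /eqP ij.
by rewrite ij eqxx in ji.
Qed.

Lemma facet_unionU1 i S : facet_union (i |: S) = F i :|: facet_union S.
Proof. by rewrite /facet_union bigcup_setU big_set1. Qed.

(** If [F i0] is inside [W], inserting or removing [i0] does not leave the cells
    inside [W], so inserting [i0] (with sign) is a contracting homotopy there. *)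
Lemma taylor_exact :
  multigraded_exact (fun S => #|S|) facet_union
    (fun W => exists i, F i \subset W) [set: {set 'I_k}] taylor_coef.
Proof.
split.
- move=> x y /taylor_coef_neq0[i iy ->]; rewrite !inE cardsU1 iy facet_unionU1.
  by split=> //; apply: subsetUr.
- move=> x z; rewrite act_taylor.
  pose f i j := if (i \in z) || (j \in i |: z) then 0 else
    (x == j |: (i |: z))%:R * (insert_sign z i * insert_sign (i |: z) j).
  rewrite big_mkcond -[RHS](sum_antisym (f := f)).
  + apply: eq_bigr => i _; case: ifP => [iz|/negbFE iz].
      rewrite /taylor_coef mulr_sumr big_mkcond; apply: eq_bigr => j _.
      by rewrite /f (negPf iz) /=; case: (j \in _) => //=; rewrite mulrCA.
    by rewrite big1 // => j _; rewrite /f iz.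
  + by move=> i; rewrite /f !inE eqxx orbT.
  + move=> i j ij; rewrite /f !inE [j == i]eq_sym (negPf ij) /= orbC.
    case: ifP => [_|/norP[jz iz]]; first by rewrite oppr0.
    by rewrite insert_sign_swap // mulrN setUCA.
- move=> W [i0 F0W] v vA vc.
  pose w x := if i0 \in x then insert_sign (x :\ i0) i0 * v (x :\ i0) else 0.
  exists w.
    move=> x; rewrite /w; case: ifP => [ix|]; last by rewrite eqxx.
    rewrite mulf_eq0 negb_or => /andP[_ /vA[_ LW]]; split; first by rewrite inE.
    by rewrite -(setD1K ix) facet_unionU1 subUset F0W.
  move=> y; rewrite act_taylor; have [iy|iy] := boolP (i0 \in y); last first.
    rewrite (bigD1 i0) //= /w setU11 setU1K // mulrA insert_sign_sq mul1r.
    rewrite big1 ?addr0 // => i /andP[_ ii0].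
    by rewrite !inE eq_sym (negPf ii0) (negPf iy) mulr0.
  have i0z : i0 \notin y :\ i0 by rewrite !inE eqxx.
  move: (vc (y :\ i0)); rewrite act_taylor (bigD1 i0) //= setD1K // => /eqP.
  rewrite addr_eq0 => /eqP vyE.
  rewrite -[v y]mul1r -(insert_sign_sq (y :\ i0) i0) -mulrA vyE mulrN mulr_sumr.
  rewrite -sumrN; apply: eq_big => [i|i /andP[iz ii0]].
    by rewrite !inE; have [->|] := eqVneq i i0; rewrite ?iy ?andbF ?andbT.
  have -> : w (i |: y) = insert_sign (i |: (y :\ i0)) i0 * v (i |: (y :\ i0)).
    rewrite /w !inE iy orbT; congr (insert_sign _ _ * v _); apply/setP => u;
      rewrite !inE; case: (eqVneq u i) => // ->; by rewrite ii0.
  rewrite !mulrA -mulNr; congr (_ * _).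
  have := insert_sign_swap i0z iz; rewrite eq_sym setD1K // => /(_ ii0) sw.
  rewrite -[RHS]mul1r -(insert_sign_sq (y :\ i0) i0) mulrACA sw.
  rewrite -[LHS]mulr1 -(insert_sign_sq (i |: (y :\ i0)) i0).
  ring.
Qed.

End Taylor.

(** * From cells to graded free resolutions *)

Section SquarefreeMonomials.
Variables (K : fieldType) (n : nat).
Implicit Types (B C : {set 'I_n}) (u m : 'X_{1..n}).

Definition set_mnm B : 'X_{1..n} := [multinom (i \in B : nat) | i < n].

Definition mnm_set u : {set 'I_n} := [set i | u i != 0%N].

Lemma set_mnm_le B u : (set_mnm B <= u)%MM = (B \subset mnm_set u).
Proof.
apply/mnm_lepP/subsetP => [le i iB|sub i].
  by have := le i; rewrite mnmE iB inE lt0n.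
by rewrite mnmE; case: (boolP (i \in B)) => // /sub; rewrite inE lt0n.
Qed.

Lemma mdeg_set_mnm B : mdeg (set_mnm B) = #|B|.
Proof.
rewrite mdegE -sum1_card [RHS]big_mkcond; apply: eq_bigr => i _.
by rewrite mnmE; case: ifP.
Qed.

Lemma set_mnmD B C : C \subset B -> (set_mnm (B :\: C) + set_mnm C)%MM = set_mnm B.
Proof.
move=> /subsetP CB; apply/mnmP => i; rewrite mnmDE !mnmE inE.
by have := CB i; case: (i \in C); case: (i \in B) => // /(_ isT).
Qed.

Lemma set_mnm0 : set_mnm set0 = 0%MM.
Proof. by apply/mnmP => i; rewrite mnm0E mnmE inE. Qed.

Lemma prod_vars B : \prod_(v in B) 'X_v = 'X_[K, set_mnm B].
Proof.
rewrite mprodXE; congr 'X_[_]; apply/mnmP => i.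
rewrite mnm_sumE mnmE.
rewrite (eq_bigr (fun j : 'I_n => (j == i : nat))) => [|j _]; last by rewrite mnm1E.
have [iB|iB] := boolP (i \in B).
  by rewrite (bigD1 i) //= eqxx big1 // => j /andP[_ /negPf->].
by rewrite big1 // => j jB; case: eqP => // ji; rewrite -ji jB in iB.
Qed.

Variables (k : nat) (F : 'I_k -> {set 'I_n}).

Definition facet_ideal : {mpoly K[n]} -> Prop :=
  ideal_gen (fun i => \prod_(v in F i) 'X_v).

Lemma facet_ideal_supp f u : facet_ideal f -> u \in msupp f ->
  exists i, F i \subset mnm_set u.
Proof.
case=> g ->; case/msupp_sum_le/flatten_mapP => i _; rewrite prod_vars => uf.
exists i; rewrite -set_mnm_le; move: uf; rewrite (perm_mem (msuppMX _ _)).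
by case/mapP => u' _ ->; apply: lem_addr.
Qed.

Lemma facet_ideal_monomial : monomial_ideal facet_ideal.
Proof.
split.
- move=> f g [a ->] [b ->]; exists (fun i => a i + b i).
  by rewrite -big_split; apply: eq_bigr => i _; rewrite mulrDl.
- move=> f g [a ->]; exists (fun i => f * a i).
  by rewrite mulr_sumr; apply: eq_bigr => i _; rewrite mulrA.
- move=> P f [a ->]; exists (fun i => mono_part (fun u => P (u + set_mnm (F i))%MM) (a i)).
  rewrite mono_part_sum; apply: eq_bigr => i _; apply: mono_partM => u w.
  by rewrite prod_vars msuppX inE => /eqP->.
Qed.

Lemma facet_ideal0 : facet_ideal 0.
Proof. by exists (fun=> 0); rewrite big1 // => i _; rewrite mul0r. Qed.

Lemma facet_ideal_mem i B f : F i \subset B -> facet_ideal (f * 'X_[set_mnm B]).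
Proof.
move=> FB; exists (fun j => if j == i then f * 'X_[set_mnm (B :\: F i)] else 0).
rewrite (bigD1 i) //= eqxx prod_vars big1 ?addr0 => [|j /negPf->]; last first.
  by rewrite mul0r.
by rewrite -mulrA -mpolyXD set_mnmD.
Qed.

End SquarefreeMonomials.

Section FreeResolution.
Variables (K : fieldType) (n k : nat) (F : 'I_k -> {set 'I_n}).
Variables (T : finType) (hd : T -> nat) (L : T -> {set 'I_n}).
Variables (A : {set T}) (c : T -> T -> K).
Let good (W : {set 'I_n}) := exists i, F i \subset W.
Hypothesis cA : multigraded_exact hd L good A c.
Implicit Types (x y z : T) (u : 'X_{1..n}).

Definition poly_coef x y : {mpoly K[n]} :=
  c x y *: 'X_[set_mnm (L x :\: L y)].

Lemma poly_coef_neq0 x y : poly_coef x y != 0 ->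
  [/\ x \in A, y \in A, hd x = (hd y).+1 & L y \subset L x].
Proof.
by rewrite scaler_eq0 negb_or => /andP[/(mg_supp cA)].
Qed.

Lemma poly_coef_sq x z : \sum_y poly_coef x y * poly_coef y z = 0.
Proof.
have step y : poly_coef x y * poly_coef y z =
    (c x y * c y z) *: 'X_[set_mnm (L x :\: L z)].
  rewrite /poly_coef -scalerAl -scalerAr scalerA -mpolyXD.
  have [->|/(mg_supp cA)[_ _ _ Lyx]] := eqVneq (c x y) 0; first by rewrite mul0r !scale0r.
  have [->|/(mg_supp cA)[_ _ _ Lzy]] := eqVneq (c y z) 0; first by rewrite mulr0 !scale0r.
  congr (_ *: 'X_[_]); apply/mnmP => i; rewrite mnmDE !mnmE !inE.
  move/subsetP: Lyx => /(_ i); move/subsetP: Lzy => /(_ i).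
  by case: (i \in L y); case: (i \in L z); case: (i \in L x) => //= Hz Hy;
    first [have := Hz isT | have := Hy isT].
under eq_bigr do rewrite step; rewrite -scaler_suml.
by have := mg_sq cA x z; rewrite /act => ->; rewrite scale0r.
Qed.

(** Exactness transfers from [K] to polynomials one monomial [M] at a time.  The
    components of [v] that contribute to total multidegree [M] form a vector
    [vt M] over [K], supported by the cells whose multidegree divides [M]; it is
    a cycle, so it bounds some [wt M], and the [wt M] are assembled into [w].  A
    bound [N] on total degrees keeps the number of monomials finite. *)
Lemma poly_exact (v : T -> {mpoly K[n]}) :
    (forall x, v x != 0 -> x \in A) ->
    (forall x u, u \in msupp (v x) -> good (mnm_set (u + set_mnm (L x))%MM)) ->
    (forall y, \sum_x v x * poly_coef x y = 0) ->
  exists2 w : T -> {mpoly K[n]}, forall x, w x != 0 -> x \in A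
    & forall y, v y = \sum_x w x * poly_coef x y.
Proof.
move=> vA vgood vD.
pose N := ((\max_x msize (v x)) + n).+1.
pose vt (M : 'X_{1..n < N}) x :=
  if (set_mnm (L x) <= M)%MM then (v x)@_(M - set_mnm (L x)) else 0.
have vt_neq0 M x : vt M x != 0 ->
    (set_mnm (L x) <= M)%MM /\ (M - set_mnm (L x))%MM \in msupp (v x).
  by rewrite /vt; case: ifP => [_|]; rewrite ?eqxx // -mcoeff_msupp.
have : forall M : 'X_{1..n < N}, exists wt : T -> K, supported L A (mnm_set M) wt /\
    forall y, vt M y = act c wt y.
  move=> M; have [/forallP vt0|] := boolP [forall x, vt M x == 0].
    exists (fun=> 0); split=> [x|y]; first by rewrite eqxx.
    by rewrite (eqP (vt0 y)) /act big1 // => x _; rewrite mul0r.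
  rewrite negb_forall => /existsP[x0 /vt_neq0[Lx0 /vgood]].
  rewrite submK // => goodM.
  have [||wt] := mg_exact cA goodM (v := vt M); last by exists wt.
    move=> x /vt_neq0[Lx]; rewrite mcoeff_msupp -set_mnm_le => vx; split=> //.
    by apply: vA; apply: contraNneq vx => ->; rewrite mcoeff0.
  move=> y; have [Ly|LyN] := boolP (set_mnm (L y) <= M)%MM; last first.
    rewrite /act big1 // => x _; have [->|/(mg_supp cA)[_ _ _ Lyx]] := eqVneq (c x y) 0.
      by rewrite mulr0.
    rewrite /vt; case: ifP; rewrite ?mul0r // !set_mnm_le => Lx.
    by move: LyN; rewrite set_mnm_le (subset_trans Lyx Lx).
  have := congr1 (mcoeff (M - set_mnm (L y))) (vD y); rewrite mcoeff0 => <-.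
  rewrite raddf_sum /act; apply: eq_bigr => x _ /=.
  rewrite -scalerAr mcoeffZ mulrC; have [->|/(mg_supp cA)[_ _ _ Lyx]] := eqVneq (c x y) 0.
    by rewrite !mul0r.
  congr (_ * _); rewrite /vt; case: ifP => [Lx|LxN].
    rewrite -(mcoeffMX _ (set_mnm (L x :\: L y))); congr (_@_ _).
    apply: (@addIm _ (set_mnm (L y))); rewrite submK //.
    by rewrite [X in (X + _)%MM]addmC -addmA set_mnmD // submK.
  apply/esym/eqP; rewrite mcoeff_eq0 (perm_mem (msuppMX _ _)).
  apply: contraFN LxN => /mapP[u _ uE]; rewrite -(submK Ly) uE.
  by rewrite [X in (X + _)%MM]addmC -addmA set_mnmD // lem_addl.
case/fin_all_exists => wt wtP.
exists (fun x => \sum_(M : 'X_{1..n < N}) wt M x *: 'X_[M - set_mnm (L x)]).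
  move=> x; apply: contraNT => xA; rewrite big1 // => M _.
  have [->|/(proj1 (wtP M))[xA']] := eqVneq (wt M x) 0; first by rewrite scale0r.
  by rewrite xA' in xA.
move=> y; transitivity (\sum_(M : 'X_{1..n < N}) vt M y *: 'X_[M - set_mnm (L y)]); last first.
  under [RHS]eq_bigr do rewrite mulr_suml.
  rewrite exchange_big; apply: eq_bigr => M _.
  rewrite (proj2 (wtP M)) /act scaler_suml; apply: eq_bigr => x _.
  rewrite /poly_coef -scalerAl -scalerAr scalerA -mpolyXD.
  have [->|/(proj1 (wtP M))[_]] := eqVneq (wt M x) 0; first by rewrite mul0r !scale0r.
  rewrite -set_mnm_le => LxM.
  have [->|/(mg_supp cA)[_ _ _ Lyx]] := eqVneq (c x y) 0; first by rewrite mulr0 !scale0r.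
  congr (_ *: 'X_[_]); apply: (@addIm _ (set_mnm (L y))).
  rewrite -addmA set_mnmD // !submK // .
  by rewrite set_mnm_le (subset_trans Lyx) // -set_mnm_le.
apply/mpolyP => u; rewrite raddf_sum /=.
have [ltN|geN] := ltnP (mdeg (u + set_mnm (L y))) N.
  rewrite (bigD1 (BMultinom ltN)) //= big1 ?addr0 => [|M neM].
    by rewrite mcoeffZ mcoeffX /vt lem_addl addmK eqxx mulr1.
  rewrite mcoeffZ mcoeffX; have [->|/vt_neq0[LyM _]] := eqVneq (vt M y) 0.
    by rewrite mul0r.
  case: eqP => [uE|_]; last by rewrite mulr0.
  by case/eqP: neM; apply/val_inj; rewrite /= -uE submK.
rewrite big1 => [|M _]; last first.
  rewrite mcoeffZ mcoeffX; have [->|/vt_neq0[LyM _]] := eqVneq (vt M y) 0.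
    by rewrite mul0r.
  case: eqP => [uE|_]; last by rewrite mulr0.
  by move: geN; rewrite -uE submK // leqNgt bmdeg.
apply: memN_msupp_eq0; apply: contraL geN => /msize_mdeg_lt ltu.
rewrite -ltnNge /N ltnS mdegD mdeg_set_mnm leq_add //.
  by apply: leq_trans (ltnW ltu) _; apply: (leq_bigmax (F := fun y => msize (v y))).
by rewrite -[leqRHS]card_ord max_card.
Qed.

Variable o : T.
Hypothesis oA : o \in A.
Hypothesis Lo : L o = set0.
Hypothesis hd0 : forall x, x \in A -> (hd x == 0%N) = (x == o).
Hypothesis hd_gt0 : forall x, x \in A -> (0 < hd x)%N -> good (L x).
Hypothesis cmin : forall x y, c x y != 0 -> L x != L y.

Definition cells i := [set x in A | hd x == i].

(** Generators in homological degree [i] are the cells of that degree; the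
    augmentation sends the unique cell [o] of degree zero to [1]. *)
Definition cell_resolution : graded_free_seq K n := {|
  grank i := #|cells i|;
  gdeg i a := #|L (enum_val a)|;
  gdiff i := \matrix_(a < #|cells i.+1|, b < #|cells i|)
    poly_coef (enum_val a) (enum_val b);
  gaug := const_mx 1
|}.

Lemma sum_cells i (g : T -> {mpoly K[n]}) :
    (forall x, g x != 0 -> x \in cells i) ->
  \sum_x g x = \sum_(a < #|cells i|) g (enum_val a).
Proof.
move=> gi; rewrite -big_enum_val [RHS]big_mkcond; apply: eq_bigr => x _ /=.
by case: ifP => // xi; apply/eqP; apply: contraFT xi => /gi.
Qed.

Definition extend_row i (v : 'rV[{mpoly K[n]}]_#|cells i|) x : {mpoly K[n]} :=
  \sum_a if enum_val a == x then v 0 a else 0.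

Lemma extend_row_val i v a : @extend_row i v (enum_val a) = v 0 a.
Proof.
rewrite /extend_row (bigD1 a) //= eqxx big1 ?addr0 // => b ba.
by rewrite (inj_eq enum_val_inj) (negPf ba).
Qed.

Lemma extend_row_cells i v x : @extend_row i v x != 0 -> x \in cells i.
Proof.
apply: contraNT => xi; rewrite /extend_row big1 // => a _; case: eqP => // aE.
by case/negP: xi; rewrite -aE enum_valP.
Qed.

Lemma row_exact i (v : 'rV[{mpoly K[n]}]_#|cells i|) :
    (forall x u, u \in msupp (extend_row v x) ->
       good (mnm_set (u + set_mnm (L x))%MM)) ->
    (forall y, \sum_x extend_row v x * poly_coef x y = 0) ->
  exists w, v = w *m gdiff cell_resolution i.
Proof.
move=> vgood vD.
have [|w wA wE] := poly_exact _ vgood vD.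
  by move=> x /extend_row_cells; rewrite inE => /andP[].
exists (\row_a w (enum_val a)); apply/rowP => b.
rewrite -extend_row_val wE mxE (sum_cells (i := i.+1)).
  by apply: eq_bigr => a _; rewrite !mxE.
move=> x; rewrite mulf_eq0 negb_or => /andP[_ /poly_coef_neq0[xA _ hx _]].
by rewrite inE xA hx eqSS; have := enum_valP b; rewrite inE => /andP[].
Qed.

(** Minimality holds because a coefficient between cells of different
    multidegree is multiplied by a nontrivial monomial. *)
Lemma cell_resolution_min :
  min_graded_free_resolution (@facet_ideal K n k F) cell_resolution.
Proof.
have [ID IM _] := @facet_ideal_monomial K n k F.
have cells0 x : x \in cells 0 -> x = o.
  by rewrite inE => /andP[xA]; rewrite hd0 // => /eqP.
have card0 : #|cells 0| = 1%N.
  rewrite (_ : cells 0 = [set o]) ?cards1 //; apply/setP => x; rewrite !inE.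
  have [xA|xA] := boolP (x \in A); first by rewrite hd0.
  by apply/esym/negbTE; apply: contraNneq xA => ->.
have augE (v : 'rV_#|cells 0|) : (v *m gaug cell_resolution) 0 0 = extend_row v o.
  rewrite mxE /extend_row; apply: eq_bigr => a _; rewrite !mxE mulr1.
  by rewrite (cells0 _ (enum_valP a)) eqxx.
split.
- move=> a u; rewrite mxE msupp1 inE => /eqP->.
  by rewrite /= (cells0 _ (enum_valP a)) Lo cards0 mdeg0.
- move=> i a b u; rewrite mxE /poly_coef => /[dup].
  rewrite {1}mcoeff_msupp mcoeffZ mulf_eq0 negb_or => /andP[/(mg_supp cA)[_ _ _ Lba] _].
  move/msuppZ_le; rewrite msuppX inE => /eqP->; rewrite /= mdeg_set_mnm.
  by rewrite cardsD (setIidPr Lba) subnKC // subset_leq_card.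
- exists (const_mx 1); rewrite augE /extend_row.
  rewrite (eq_bigr (fun=> 1)) => [|a _]; last first.
    by rewrite (cells0 _ (enum_valP a)) eqxx mxE.
  by rewrite sumr_const card_ord card0 subrr; apply: facet_ideal0.
- move=> v; split=> [|[w vE]].
    rewrite augE => Iv; apply: row_exact => [x u uv|y].
      have xo : x = o.
        by apply/cells0/(@extend_row_cells _ v); apply: contraTneq uv => ->; rewrite msupp0.
      by move: uv; rewrite xo Lo set_mnm0 addm0; apply: facet_ideal_supp.
    rewrite big1 // => x _; have [->|/extend_row_cells/cells0->] :=
      eqVneq (extend_row v x) 0; first by rewrite mul0r.
    have [->|/poly_coef_neq0[_ _ ho _]] := eqVneq (poly_coef o y) 0; first by rewrite mulr0.
    by have := hd0 oA; rewrite eqxx ho.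
  rewrite vE -mulmxA mxE; elim/big_ind: _ => // [|a _]; first exact: facet_ideal0.
  apply: IM; rewrite mxE; elim/big_ind: _ => // [|b _]; first exact: facet_ideal0.
  rewrite !mxE mulr1 /poly_coef (cells0 _ (enum_valP b)) Lo setD0 -mul_mpolyC.
  have [i Fi] : good (L (enum_val a)).
    by have := enum_valP a; rewrite inE => /andP[aA /eqP ha]; apply: hd_gt0; rewrite ?ha.
  exact: facet_ideal_mem Fi.
- move=> i v; split=> [v0|[w ->]].
    apply: row_exact => [x u uv|y].
      have : x \in cells i.+1.
        by apply: (@extend_row_cells _ v); apply: contraTneq uv => ->; rewrite msupp0.
      rewrite inE => /andP[xA /eqP hx].
      have [|j Fj] := hd_gt0 xA; first by rewrite hx.
      exists j; rewrite (subset_trans Fj) // -set_mnm_le; exact: lem_addl.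
    have [yi|yi] := boolP (y \in cells i); last first.
      rewrite big1 // => x _; have [->|/extend_row_cells] := eqVneq (extend_row v x) 0.
        by rewrite mul0r.
      rewrite inE => /andP[_ /eqP hx].
      have [->|/poly_coef_neq0[_ yA hy _]] := eqVneq (poly_coef x y) 0; first by rewrite mulr0.
      by case/negP: yi; rewrite inE yA -eqSS -hy hx eqxx.
    have := congr1 (fun M : 'M_(_, _) => M 0 (enum_rank_in yi y)) v0; rewrite !mxE => vy.
    rewrite -[RHS]vy (sum_cells (i := i.+1)) => [|x].
      apply: eq_bigr => a _; rewrite extend_row_val mxE.
      by rewrite enum_rankK_in.
    by rewrite mulf_eq0 negb_or => /andP[/extend_row_cells].
  suff -> : (w *m gdiff cell_resolution i.+1) *m gdiff cell_resolution i = 0 by [].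
  rewrite -mulmxA; suff -> : gdiff cell_resolution i.+1 *m gdiff cell_resolution i = 0.
    by rewrite mulmx0.
  apply/matrixP => a b; rewrite !mxE -[RHS](poly_coef_sq (enum_val a) (enum_val b)).
  rewrite (sum_cells (i := i.+1)); first by apply: eq_bigr => j _; rewrite !mxE.
  move=> y; rewrite mulf_eq0 negb_or => /andP[_ /poly_coef_neq0[yA _ hy _]].
  by rewrite inE yA hy; have := enum_valP b; rewrite inE => /andP[_ /eqP->] /=.
- move=> i a b; rewrite mxE mcoeffZ mcoeffX.
  have [->|cab] := eqVneq (c (enum_val a) (enum_val b)) 0; first by rewrite mul0r.
  have [_ _ _ Lba] := mg_supp cA cab; have := cmin cab.
  rewrite eqEsubset Lba andbT -setD_eq0 -cards_eq0 -mdeg_set_mnm mdeg_eq0.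
  by move/negPf=> ->; rewrite mulr0.
Qed.

Lemma cell_betti i j : #|[set a : 'I_(grank cell_resolution i) | gdeg a == j]| =
  #|[set x in A | (hd x == i) && (#|L x| == j)]|.
Proof.
rewrite -(card_imset _ enum_val_inj); apply: eq_card => x.
rewrite !inE; apply/imsetP/and3P => [[a]|[xA hx Lx]].
  rewrite inE => aj ->; have := enum_valP a; rewrite inE => /andP[-> ->].
  by split.
have xi : x \in cells i by rewrite inE xA.
by exists (enum_rank_in xi x); rewrite ?inE /= enum_rankK_in.
Qed.

End FreeResolution.

(** * Matching and counting in the cyclic order *)

Section Positions.
Variable k : nat.
Implicit Types (S : {set 'I_k}) (i j : nat).

(** Membership on [nat] rather than on ordinals, so that positions can be shifted
    past [k], where it is false. *)
Definition has_el S i : bool := [exists x : 'I_k, (x \in S) && (x == i :> nat)].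

Lemma has_elP S (x : 'I_k) : has_el S x = (x \in S).
Proof.
apply/existsP/idP => [[y /andP[yS /eqP/val_inj<-]] //|xS].
by exists x; rewrite xS /=.
Qed.

Lemma has_el_lt S i : has_el S i -> (i < k)%N.
Proof. by case/existsP => x /andP[_ /eqP<-]. Qed.

Lemma has_el_ex S i : has_el S i -> exists2 x : 'I_k, x \in S & i = x.
Proof. by case/existsP => x /andP[xS /eqP<-]; exists x. Qed.

Lemma has_elU S (q : 'I_k) i : has_el (q |: S) i = (i == q) || has_el S i.
Proof.
have [ik|ki] := ltnP i k.
  have -> : i = Ordinal ik by [].
  by rewrite !has_elP !inE.
rewrite !(contraFF (@has_el_lt _ _)) ?ltnNge ?ki // orbF.
by case: eqP => // iq; move: ki; rewrite iq leqNgt ltn_ord.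
Qed.

(** The least positive element, or [k] (that is, [0] once around the cycle) if
    there is none. *)
Definition first_el S : nat := (find (has_el S) (iota 1 k.-1)).+1.

Lemma first_el_ge S i : has_el S i -> (0 < i)%N -> (first_el S <= i)%N.
Proof.
move=> Si i0; rewrite /first_el leqNgt ltnS; apply/negP => lt.
have ik := has_el_lt Si.
have {}lt : (i.-1 < find (has_el S) (iota 1 k.-1))%N by lia.
have := before_find 0%N lt; rewrite nth_iota; last by lia.
by rewrite add1n prednK // Si.
Qed.

Lemma first_el_le S : (0 < k)%N -> (first_el S <= k)%N.
Proof.
by move=> k0; have := find_size (has_el S) (iota 1 k.-1); rewrite size_iota /first_el; lia.
Qed.

Lemma first_el_has S : (first_el S < k)%N -> has_el S (first_el S).
Proof.
rewrite /first_el => lt.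
have h : has (has_el S) (iota 1 k.-1) by rewrite has_find size_iota; lia.
by have := nth_find 0%N h; rewrite nth_iota ?add1n //; rewrite has_find size_iota in h.
Qed.

Lemma first_el_unique S a : has_el S a -> (0 < a)%N ->
  (forall i, (0 < i)%N -> has_el S i -> (a <= i)%N) -> first_el S = a.
Proof.
move=> Sa a0 amin; apply/eqP; rewrite eqn_leq first_el_ge //= amin //.
by apply: first_el_has; apply: leq_ltn_trans (first_el_ge Sa a0) (has_el_lt Sa).
Qed.

End Positions.

Section CyclicMatching.
Variables (k t : nat).
Implicit Types (S : {set 'I_k}) (i j c e : nat).

(** The two neighbours of [0] in [S] minus [0] are more than [t] apart, so that
    [0] cannot be switched without changing the covered positions.  The last
    element [x] gives the strongest condition. *)
Definition zero_free S : bool :=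
  [forall x in S, (0 < x)%N ==> (x + t < k + first_el S)%N].

Lemma zero_freeP S : reflect
  (forall i, has_el S i -> (0 < i)%N -> (i + t < k + first_el S)%N) (zero_free S).
Proof.
apply: (iffP forall_inP) => [H i /has_el_ex[x xS ->] x0|H x xS].
  by have := H x xS; rewrite x0.
by apply/implyP; apply: H; rewrite has_elP.
Qed.

(** The scan of the positions below [i]: [next_free S i] is the position from
    which the next block may start. *)
Fixpoint next_free S i : nat :=
  if i is i'.+1 then
    if (next_free S i' <= i')%N && has_el S i' then (i' + t).+1 else next_free S i'
  else 1.

Definition block_start S c : bool := (next_free S c <= c)%N && has_el S c.

Lemma next_freeS S i : next_free S i.+1 =
  if block_start S i then (i + t).+1 else next_free S i.
Proof. by []. Qed.

Lemma next_free_mono S i j : (i <= j)%N -> (next_free S i <= next_free S j)%N.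
Proof.
elim: j => [|j IH]; first by rewrite leqn0 => /eqP->.
rewrite leq_eqVlt => /predU1P[-> //|/IH le]; apply: leq_trans le _.
by rewrite next_freeS; case: ifP => // /andP[]; lia.
Qed.

Lemma next_free_gt0 S i : (0 < next_free S i)%N.
Proof. exact: (@next_free_mono S 0 i). Qed.

Lemma block_start_gt0 S c : block_start S c -> (0 < c)%N.
Proof. by case/andP => le _; apply: leq_trans le; apply: next_free_gt0. Qed.

Lemma next_free_start S c i : block_start S c -> (c < i)%N ->
  (c + t < next_free S i)%N.
Proof. by move=> Sc /(next_free_mono S); rewrite next_freeS Sc. Qed.

Lemma block_start_sep S c c' : block_start S c -> block_start S c' -> (c < c')%N ->
  (c + t < c')%N.
Proof. by move=> Sc /andP[le _] lt; apply: leq_trans (next_free_start Sc lt) le. Qed.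

Lemma next_free_block S c i : block_start S c -> (c < i <= (c + t).+1)%N ->
  next_free S i = (c + t).+1.
Proof.
move=> bc; elim: i => // i IH /andP[]; rewrite ltnS leq_eqVlt => /predU1P[<- _|ci it].
  by rewrite next_freeS bc.
rewrite next_freeS /block_start IH ?ci ?(ltnW it) //.
by rewrite leqNgt it.
Qed.

Lemma next_free_agree S S' i :
    (forall j, (0 < j < i)%N -> has_el S j = has_el S' j) ->
  next_free S i = next_free S' i.
Proof.
elim: i => //= i IH agree; rewrite -IH => [|j /andP[j0 ji]]; last first.
  by apply: agree; rewrite j0 ltnW.
have [i0|i0] := posnP i; last by rewrite agree // i0 ltnSn.
by rewrite i0 /=.
Qed.

Lemma next_free_spec S i :
  (next_free S i = 1%N /\ forall j, (0 < j < i)%N -> ~~ has_el S j) \/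
  exists c, [/\ (c < i)%N, block_start S c, next_free S i = (c + t).+1
    & forall j, (c + t < j < i)%N -> ~~ has_el S j].
Proof.
elim: i => [|i IH]; first by left; split=> // j; rewrite ltn0 andbF.
rewrite next_freeS; case: ifP => [Si|SiN].
  right; exists i; split=> // j; lia.
have SiN' : (next_free S i <= i)%N -> ~~ has_el S i.
  by move=> le; move: SiN; rewrite /block_start le /= => ->.
case: IH => [[f1 H]|[c [ci Sc fc H]]].
  left; split=> // j /andP[j0]; rewrite ltnS leq_eqVlt => /predU1P[jE|ji].
    by rewrite jE SiN' // f1 -jE.
  by apply: H; rewrite j0.
right; exists c; split=> //; first exact: ltnW.
move=> j /andP[cj]; rewrite ltnS leq_eqVlt => /predU1P[jE|ji].
  by rewrite jE SiN' // fc -jE.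
by apply: H; rewrite cj.
Qed.

(** Some element follows [c + 1] inside the block of [c], where [0] also counts
    as the element [k] that closes the cycle: then [c + 1] lies between two
    elements at distance at most [t]. *)
Definition hits S c : bool :=
  [exists x in S, (c.+2 <= x <= c + t)%N] || has_el S 0 && (c.+2 <= k <= c + t)%N.

Lemma hitsP S c : reflect
  ((exists2 e, has_el S e & (c.+2 <= e <= c + t)%N) \/
    has_el S 0 /\ (c.+2 <= k <= c + t)%N) (hits S c).
Proof.
apply: (iffP orP) => -[].
- by case/exists_inP => x xS cx; left; exists (x : nat); rewrite ?has_elP.
- by case/andP; right.
- by case=> e /has_el_ex[x xS ->] cx; left; apply/exists_inP; exists x.
- by case=> h0 ck; right; rewrite h0.
Qed.

(** The middle condition is that [c + 1], once in [S], still leaves [0]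
    uncovered by its neighbours, so that switching it preserves [zero_free]. *)
Definition switchable S c : bool :=
  [&& block_start S c, (c.+1 + t < k + first_el S)%N & hits S c].

Lemma switchable_lt S c : switchable S c -> (c.+1 < k)%N.
Proof. by case/and3P => _ _ /hitsP[[e /has_el_lt]|[_]]; lia. Qed.

(** The element that the matching switches; a value of at least [k] means that
    [S] is unmatched. *)
Definition pivot S : nat :=
  if zero_free S then (find (switchable S) (iota 0 k)).+1 else 0%N.

Lemma pivot_start S c : zero_free S -> switchable S c ->
  (forall c', (c' < c)%N -> ~~ switchable S c') -> pivot S = c.+1.
Proof.
move=> zS Sc H; rewrite /pivot zS; congr _.+1.
have ck : (c < k)%N by have := switchable_lt Sc; lia.
have h : has (switchable S) (iota 0 k).
  by apply/hasP; exists c => //; rewrite mem_iota.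
apply/eqP; rewrite eqn_leq; apply/andP; split; rewrite leqNgt; apply/negP => lt.
  by have := before_find 0%N lt; rewrite nth_iota // Sc.
have := nth_find 0%N h; rewrite nth_iota; last by rewrite has_find size_iota in h.
by rewrite add0n (negPf (H _ lt)).
Qed.

Lemma pivotP S : (pivot S < k)%N -> zero_free S ->
  exists c, [/\ pivot S = c.+1, switchable S c
    & forall c', (c' < c)%N -> ~~ switchable S c'].
Proof.
rewrite /pivot => lt zS; rewrite zS in lt *.
set c := find _ _ in lt *; exists c.
have h : has (switchable S) (iota 0 k) by rewrite has_find size_iota -/c; lia.
split=> // [|c' lt'].
  by have := nth_find 0%N h; rewrite nth_iota // -/c; lia.
by have := before_find 0%N lt'; rewrite nth_iota ?add0n => [->|]; lia.
Qed.

Definition critical S : Prop := zero_free S /\ forall c, ~~ switchable S c.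

Lemma pivot_critical S : ~~ (pivot S < k)%N -> (0 < k)%N -> critical S.
Proof.
rewrite /pivot; case: ifP => [zS|_]; last by move=> /negP h /h.
move=> h k0; split=> // c; apply/negP => Sc; case/negP: h.
have ck := switchable_lt Sc.
suff : (find (switchable S) (iota 0 k) <= c)%N by lia.
rewrite leqNgt; apply/negP => /(before_find 0%N).
by rewrite nth_iota ?Sc; lia.
Qed.

Lemma critical_pivot S : critical S -> ~~ (pivot S < k)%N.
Proof.
case=> zS H; apply/negP => /pivotP/(_ zS)[c [_ Sc _]].
by move: (H c); rewrite Sc.
Qed.

(** Switching the pivot is an involution: the scan up to [c] does not see
    [c + 1], and neither do the conditions tested at [c] and at earlier block
    starts, whose blocks end before [c]. *)
Lemma pivot_toggle S S' : (pivot S < k)%N ->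
    (forall i, i != pivot S -> has_el S' i = has_el S i) ->
  pivot S' = pivot S.
Proof.
move=> pk agree; have [zS|zSN] := boolP (zero_free S); last first.
  have p0 : pivot S = 0%N by rewrite /pivot (negPf zSN).
  rewrite p0 in agree *; have fE : first_el S' = first_el S.
    rewrite /first_el; congr _.+1; apply: eq_in_find => i.
    by rewrite mem_iota => /andP[i0 _]; apply: agree; rewrite -lt0n.
  rewrite /pivot; case: ifP => // /zero_freeP zS'; case/negP: zSN.
  apply/zero_freeP => i Si i0; rewrite -fE; apply: zS' => //.
  by rewrite agree // -lt0n.
have [c [pE Sc cmin]] := pivotP pk zS; rewrite pE in agree *.
have [bc ct hc] := and3P Sc.
have c0 := block_start_gt0 bc.
have [_ elc] := andP bc.
have fc : (first_el S <= c)%N by apply: first_el_ge.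
have fE : first_el S' = first_el S.
  apply: first_el_unique => //.
    rewrite agree; last by lia.
    by apply: first_el_has; have := has_el_lt elc; lia.
  move=> i i0; have [->|ic] := eqVneq i c.+1; first by lia.
  by rewrite agree // => Si; apply: first_el_ge.
have nfE i : (i <= c.+1)%N -> next_free S' i = next_free S i.
  by move=> ic; apply: next_free_agree => j ji; apply: agree; lia.
apply: pivot_start.
- apply/zero_freeP => i; rewrite fE; have [->|ic] := eqVneq i c.+1; first by lia.
  by rewrite agree //; apply/zero_freeP.
- apply/and3P; split; last 1 first.
  + apply/hitsP; case/hitsP: hc => [[e Se ec]|[S0 ck]].
      by left; exists e => //; rewrite agree //; lia.
    by right; rewrite agree.
  + by rewrite /block_start nfE // agree; [exact: bc | lia].
  + by rewrite fE.
move=> c' c'c; apply: contra (cmin _ c'c) => /and3P[bc' ct' hc'].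
have bc'S : block_start S c'.
  by move: bc'; rewrite /block_start nfE ?agree //; lia.
have sep := block_start_sep bc'S bc c'c.
apply/and3P; split=> //; first by rewrite -fE.
apply/hitsP; case/hitsP: hc' => [[e Se ec]|[S0 ck]].
  by left; exists e => //; rewrite -agree //; lia.
by right; rewrite -agree.
Qed.

Definition covers i j : bool := if (i <= j)%N then (j - i < t)%N else (j + k - i < t)%N.

Definition covered S j : bool := [exists x in S, covers x j].

Lemma coveredP S j : reflect (exists2 i, has_el S i & covers i j) (covered S j).
Proof.
apply: (iffP exists_inP) => [[x xS cx]|[i /has_el_ex[x xS ->] cx]].
  by exists (x : nat); rewrite ?has_elP.
by exists x.
Qed.

(** The primary component of the order in which pairs are cancelled within one
    multidegree; pairs that switch [0] come first. *)
Definition scan_origin S : nat := if zero_free S then first_el S else 0%N.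

Lemma toggle_origin S S' : (pivot S < k)%N ->
    (forall i, i != pivot S -> has_el S' i = has_el S i) ->
  scan_origin S' = scan_origin S.
Proof.
move=> pk agree; have pS' := pivot_toggle pk agree.
have z_pivot X : zero_free X = (0 < pivot X)%N by rewrite /pivot; case: ifP.
rewrite /scan_origin !z_pivot pS'; case: ifP => //; rewrite -z_pivot => zS.
have [c [pE Sc _]] := pivotP pk zS; have [bc _ _] := and3P Sc.
have c0 := block_start_gt0 bc; have [_ elc] := andP bc.
have fc : (first_el S <= c)%N by apply: first_el_ge.
apply: first_el_unique => //.
  rewrite agree; last by lia.
  by apply: first_el_has; have := has_el_lt elc; lia.
move=> i i0; have [->|ic] := eqVneq i (pivot S); first by lia.
by rewrite agree // => Si; apply: first_el_ge.
Qed.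

(** Acyclicity of the matching within one multidegree.  Here [S] is the lower
    cell of a pair and [q |: S] the upper cell of another one, where [covered S q]
    holds because both have the same multidegree.  Unless [q] makes [0]
    switchable or comes in front of all blocks, which decreases [scan_origin],
    the scan of [q |: S] stops at the block start [c] of [S] or earlier, and at
    [c] itself [q |: S] would be a lower cell.  Indeed [q] cannot lie between two
    blocks before [c], where it would be uncovered; inside an earlier block it
    makes that block switchable or is ignored by the scan; and [0] or a position
    after [c] leaves the block of [c] switchable. *)
Lemma pivot_decrease S (q : 'I_k) :
    (pivot S < k)%N -> ~~ has_el S (pivot S) ->
    q \notin S -> (q : nat) != pivot S -> covered S q ->
    (pivot (q |: S) < k)%N -> has_el (q |: S) (pivot (q |: S)) ->
  (scan_origin (q |: S) < scan_origin S)%N \/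
  scan_origin (q |: S) = scan_origin S /\ (pivot (q |: S) < pivot S)%N.
Proof.
move=> pk pS qS qp /coveredP[i Si cov] pk' pS'.
have elU j : has_el (q |: S) j = (j == q) || has_el S j by apply: has_elU.
have sub j : has_el S j -> has_el (q |: S) j by rewrite elU orbC => ->.
have [zS|zSN] := boolP (zero_free S); last first.
  have p0 : pivot S = 0%N by rewrite /pivot (negPf zSN).
  have [zS'|zSN'] := boolP (zero_free (q |: S)).
    case/negP: zSN; apply/zero_freeP => j Sj j0.
    apply: leq_trans (zero_freeP _ zS' _ (sub _ Sj) j0) _; rewrite leq_add2l.
    have fj := first_el_ge Sj j0; have f1 := first_el_ge (sub _ Sj) j0.
    apply: first_el_ge; last by [].
    by apply/sub/first_el_has; apply: leq_ltn_trans fj (has_el_lt Sj).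
  move: pS'; rewrite /pivot (negPf zSN') elU => /orP[/eqP q0|S0].
    by case/eqP: qp; rewrite p0.
  by rewrite p0 S0 in pS.
have [c [pE Sc cmin]] := pivotP pk zS.
have [bc ct hc] := and3P Sc.
have c0 := block_start_gt0 bc; have [_ elc] := andP bc.
have fc : (first_el S <= c)%N by apply: first_el_ge.
have fS : has_el S (first_el S).
  by apply: first_el_has; apply: leq_ltn_trans fc (has_el_lt elc).
have so : scan_origin S = first_el S by rewrite /scan_origin zS.
have [zS'|zSN'] := boolP (zero_free (q |: S)); last first.
  by left; rewrite so /scan_origin (negPf zSN').
have so' : scan_origin (q |: S) = first_el (q |: S) by rewrite /scan_origin zS'.
have fle : (first_el (q |: S) <= first_el S)%N by apply: first_el_ge => //; apply: sub.
move: fle; rewrite leq_eqVlt => /predU1P[fE|]; last by rewrite so so'; left.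
right; rewrite so so'; split=> //.
suff [c' c'c Sc'] : exists2 c', (c' <= c)%N & switchable (q |: S) c'.
  have [d [dE Sd dmin]] := pivotP pk' zS'.
  have dc' : (d <= c')%N by rewrite leqNgt; apply/negP => /dmin; rewrite Sc'.
  rewrite ltn_neqAle dE pE eqSS ltnS (leq_trans dc' c'c) andbT.
  apply: contraNneq pS => dc; move: pS'; rewrite dE pE dc elU.
  by rewrite -pE eq_sym (negPf qp).
have hitU c' : hits S c' -> hits (q |: S) c'.
  case/hitsP => [[e Se ec]|[S0 ck]]; apply/hitsP; first by left; exists e; rewrite ?sub.
  by right; rewrite sub.
have q_lt : (0 < q)%N -> (first_el S < q)%N.
  move=> q0; rewrite ltn_neqAle -fE first_el_ge ?elU ?eqxx // andbT fE.
  by apply: contraNneq qS => fq; rewrite -has_elP -fq.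
have nfU j : (j <= q)%N \/ q = 0%N :> nat -> next_free (q |: S) j = next_free S j.
  move=> jq; apply: next_free_agree => i' ij; rewrite elU; case: eqP => // i'q.
  exfalso; move: ij; rewrite i'q => /andP[q0 qj].
  by case: jq => [|q0']; [rewrite leqNgt qj | rewrite q0' in q0].
have [qc|qc] := boolP ((c <= q)%N || (q == 0%N :> nat)).
  exists c => //; apply/and3P; split; last exact: hitU.
    rewrite /block_start sub // nfU; first by case/andP: bc => ->.
    by case/orP: qc => [|/eqP]; [left|right].
  by rewrite fE.
move: qc; rewrite negb_or -ltnNge -lt0n => /andP[qc q0].
have f1 := q_lt q0.
have := next_free_spec S q; case=> [[_ H]|[c' [c'q bc' fc' H]]].
  by have := H _ (introT andP (conj _ f1)); rewrite fS => /(_ isT).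
have bc'U : block_start (q |: S) c'.
  have [b1 b2] := andP bc'.
  by rewrite /block_start sub // nfU ?b1 //; left; apply: ltnW.
have sep := block_start_sep bc' bc (ltn_trans c'q qc).
have [qhit|qbig] := leqP q (c' + t)%N; last first.
  (* an element within distance t before q would lie in the block of c' and make
     that block switchable *)
  exfalso; move: cov; rewrite /covers; case: (leqP i q) => iq cov; last first.
    have := zero_freeP _ zS i Si (leq_ltn_trans (leq0n _) iq).
    by have := has_el_lt Si; clear -f1 cov; lia.
  have [i0|i0] := posnP i; first by move: cov; rewrite i0; clear -qbig; lia.
  have iNq : i != q by apply: contraNneq qS => iq'; rewrite -has_elP -iq'.
  have ic't : (c' + t < i)%N.
    rewrite ltnNge; apply/negP => ic'; case/negP: (cmin _ (ltn_trans c'q qc)).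
    apply/and3P; split=> //; first by clear -sep fc ct qc c'q; lia.
    apply/hitsP; left; exists i => //.
    by clear -cov iq qbig ic' iNq; lia.
  by have := H i; rewrite Si ic't ltn_neqAle iNq iq => /(_ isT).
(* at c' + 1 the element q is ignored by the scan, deeper in the block it is hit *)
have [qE|qN] := eqVneq (q : nat) c'.+1; last first.
  exists c'; first exact: ltnW (ltn_trans c'q qc).
  apply/and3P; split=> //; first by rewrite fE; clear -ct sep; lia.
  apply/hitsP; left; exists q; first by rewrite elU eqxx.
  by clear -qN qhit c'q; lia.
exists c => //; apply/and3P; split; last exact: hitU; last by rewrite fE.
rewrite /block_start sub // andbT.
suff -> : next_free (q |: S) c = next_free S c by case/andP: bc.
have blocked : forall j, (c' < j)%N -> (j <= c)%N ->
    next_free (q |: S) j = next_free S j.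
  elim=> // j IH; rewrite ltnS leq_eqVlt => /predU1P[<- _|c'j jc].
    by rewrite !next_freeS bc' bc'U.
  rewrite !next_freeS /block_start IH // ?elU; last exact: ltnW.
  case: eqP => // jq; have := next_free_start bc' c'j; rewrite {1}jq => nfq.
  by rewrite leqNgt jq (leq_ltn_trans qhit nfq).
exact: blocked (ltn_trans c'q qc) (leqnn c).
Qed.

Lemma uncovered_intro S j :
    (forall i, has_el S i -> (i <= j)%N -> (i + t <= j)%N) ->
    (forall i, has_el S i -> (j < i)%N -> (i + t <= k + j)%N) ->
  ~~ covered S j.
Proof.
move=> low high; apply/coveredP => -[i Si]; have := has_el_lt Si; rewrite /covers.
by case: (leqP i j) => ij; [have := low i Si ij | have := high i Si ij];
  clear; lia.
Qed.

Hypothesis t_gt0 : (0 < t)%N.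

Section CriticalSet.
Variable S : {set 'I_k}.
Hypothesis critS : critical S.
Hypothesis k_gt0 : (0 < k)%N.
Let a := first_el S.
Let el i : nat := has_el S i.
Let un j : nat := ~~ covered S j.
Let a_gt0 : (0 < a)%N. Proof. exact: ltn0Sn. Qed.
Let a_le : (a <= k)%N. Proof. exact: first_el_le. Qed.

Lemma critical_high i : has_el S i -> (0 < i)%N -> (i + t < k + a)%N.
Proof. by case: critS => /zero_freeP zS _; apply: zS. Qed.

Lemma critical_block c : block_start S c -> (c.+1 + t < k + a)%N -> ~~ hits S c.
Proof.
by move=> bc ct; case: critS => _ /(_ c); rewrite /switchable bc ct.
Qed.

Lemma critical_gap c e : block_start S c -> (c.+1 < e <= c + t)%N -> ~~ has_el S e.
Proof.
move=> bc /andP[ce ec]; apply/negP => Se.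
have /critical_high : has_el S e := Se.
have e0 : (0 < e)%N by apply: leq_ltn_trans ce.
move=> /(_ e0) et; have ct : (c.+1 + t < k + a)%N by clear -et ce; lia.
case/negP: (critical_block bc ct); apply/hitsP; left; exists e => //.
by rewrite ce.
Qed.

(** At a position outside the blocks all the windows that started earlier, at a
    positive position, have ended. *)
Lemma critical_low i e : (next_free S i <= i)%N -> has_el S e -> (0 < e < i)%N ->
  (e + t <= i)%N.
Proof.
move=> fi Se e0i; case: (next_free_spec S i) => [[_ /(_ e e0i)]|[c [ci bc fc H]]].
  by rewrite Se.
rewrite fc in fi; case/andP: e0i => e0 ei.
have [ec|ec] := leqP e c.+1; first by clear -ec fi; lia.
have [ect|ect] := leqP e (c + t)%N.
  by have := critical_gap bc (introT andP (conj ec ect)); rewrite Se.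
by have := H e (introT andP (conj ect ei)); rewrite Se.
Qed.

Lemma uncovered_out i : (a <= i)%N -> (next_free S i <= i)%N -> ~~ has_el S i ->
  (i < k)%N -> ~~ covered S i.
Proof.
move=> ai fi SiN ik; apply: uncovered_intro => e Se.
  move=> ei; have [e0|e0] := posnP e; last first.
    apply: critical_low => //; rewrite e0 ltn_neqAle ei andbT.
    by apply: contraNneq SiN => <-.
  rewrite e0 add0n; case: (next_free_spec S i) => [[_ H]|[c [ci bc fc _]]].
    have Sa : has_el S a by apply: first_el_has; apply: leq_ltn_trans ai ik.
    have [ia|ia] := eqVneq a i; first by rewrite -ia Sa in SiN.
    by have := H a; rewrite a_gt0 ltn_neqAle ia ai Sa => /(_ isT).
  by rewrite fc in fi; clear -fi; lia.
move=> ie; have := critical_high Se (leq_ltn_trans (leq0n _) ie).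
by clear -ai; lia.
Qed.

Lemma uncovered_block_end c : block_start S c -> ~~ has_el S c.+1 ->
  (c + t < k)%N -> ~~ covered S (c + t)%N.
Proof.
move=> bc ScN ck; have [_ Sc] := andP bc; have c0 := block_start_gt0 bc.
have ac : (a <= c)%N by apply: first_el_ge.
apply: uncovered_intro => e Se.
  move=> ect; have [ec|ec] := leqP e c; first by rewrite leq_add2r.
  have [ecS|ecS] := eqVneq e c.+1; first by rewrite ecS (negPf ScN) in Se.
  have := @critical_gap c e bc; rewrite ect andbT ltn_neqAle ec andbT eq_sym ecS Se.
  by move=> /(_ isT).
move=> cte; have := critical_high Se (leq_ltn_trans (leq0n _) cte).
by clear -ac; lia.
Qed.

Lemma sum_block (f : nat -> nat) c : (\sum_(c <= j < (c + t).+1) f j =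
  f c + f c.+1 + \sum_(c.+2 <= j < (c + t).+1) f j)%N.
Proof.
rewrite big_ltn; last by clear; lia.
by rewrite big_ltn ?addnA //; move: t_gt0; clear; lia.
Qed.

Lemma block_elements c i : block_start S c -> (i <= (c + t).+1)%N ->
  \sum_(c.+2 <= j < i) el j = 0%N.
Proof.
move=> bc ic; rewrite big_nat big1 // => j /andP[cj ji].
by rewrite /el (negPf (critical_gap bc _)) // cj -ltnS (leq_trans ji ic).
Qed.

(** A block with the single element [c] has an uncovered last position. *)
Lemma block_weight c : block_start S c -> (c + t < k)%N ->
  (\sum_(c <= j < (c + t).+1) el j <= 2)%N /\
  (2 <= \sum_(c <= j < (c + t).+1) el j + \sum_(c <= j < (c + t).+1) un j)%N.
Proof.
move=> bc ck; have [_ Sc] := andP bc.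
rewrite sum_block block_elements // addn0 /el Sc.
have [ScS|ScS] := boolP (has_el S c.+1); first by clear; lia.
rewrite big_nat_recr /=; last by clear; lia.
by rewrite {2}/un uncovered_block_end //; clear; lia.
Qed.

Let el_sum : #|S| = (el 0 + \sum_(a <= j < k) el j)%N.
Proof.
have -> : #|S| = (\sum_(0 <= j < k) el j)%N.
  rewrite -sum1_card big_mkord big_mkcond; apply: eq_bigr => x _.
  by rewrite /el has_elP; case: ifP.
rewrite big_ltn // (big_cat_nat (n := a)) //= [X in (_ + (X + _))%N]big_nat.
rewrite big1 ?add0n // => j /andP[j0 ja]; rewrite /el.
by case: (boolP (has_el S j)) => // /first_el_ge/(_ j0); rewrite leqNgt ja.
Qed.

Let un_sum : #|[set j : 'I_k | ~~ covered S j]| =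
  (\sum_(0 <= j < a) un j + \sum_(a <= j < k) un j)%N.
Proof.
rewrite -big_cat_nat //= big_mkord -sum1_card [LHS]big_mkcond.
by apply: eq_bigr => x _; rewrite inE /un; case: (covered S x).
Qed.

Let un_count i : (i <= a)%N -> (forall j, (i <= j < a)%N -> ~~ covered S j) ->
  (a - i <= \sum_(0 <= j < a) un j)%N.
Proof.
move=> ia H; rewrite (big_cat_nat (n := i)) //= -[X in (X <= _)%N]muln1 -sum_nat_const_nat.
apply: leq_trans (leq_addl _ _).
by rewrite big_nat [leqRHS]big_nat; apply: leq_sum => j /H uj; rewrite /un uj.
Qed.

(** Outcome of cutting the cycle, from [first_el S] on, into blocks of length
    [t.+1], with [N] elements and [X] elements or uncovered positions.  Either
    the [r] blocks fit and the positions outside them are uncovered, or the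
    element [0] starts one more block, which is cut to length [b = first_el S].
    With [x] positions outside the blocks, [X >= 2 * r + x] in the first case and
    [X >= 1 + 2 * r + x] in the second; [x] has been eliminated. *)
Definition block_count (N X : nat) : Prop :=
  (exists r, [/\ (t.+1 * r <= k)%N, (N <= 2 * r)%N & (2 * r + k <= X + t.+1 * r)%N]) \/
  (exists r b, [/\ (0 < b <= t)%N, (t.+1 * r + b <= k)%N, (N <= 1 + 2 * r)%N
    & (1 + 2 * r + k <= X + t.+1 * r + b)%N]).

(** The scan stands at a position [i] outside the blocks, after [r] blocks and
    [nb] positions outside them; it moves on by one position or one block until
    it reaches the end of the cycle, where the last block may be cut. *)
Lemma scan_blocks i r nb : (a <= i <= k)%N -> (next_free S i <= i)%N ->
    i = (a + t.+1 * r + nb)%N ->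
    (\sum_(a <= j < i) el j <= 2 * r)%N ->
    (2 * r + nb <= \sum_(a <= j < i) el j + \sum_(a <= j < i) un j)%N ->
  block_count #|S| (#|S| + #|[set j : 'I_k | ~~ covered S j]|).
Proof.
have [m] := ubnP (k - i); elim: m i r nb => // m IH i r nb ltm.
move=> /andP[ai ik] fi iE N U.
have elN e : has_el S e -> (0 < e)%N -> (a <= e)%N by apply: first_el_ge.
have [ki|ltik] := leqP k i.
  (* the last block ends before the cycle closes up *)
  have {ai ik ltm ki} ik' : i = k by apply/eqP; rewrite eqn_leq ik.
  rewrite {i}ik' in fi iE N U *; have low e : has_el S e -> (0 < e)%N -> (e + t <= k)%N.
    by move=> Se e0; apply: (critical_low fi Se); rewrite e0 (has_el_lt Se).
  have un_low j : (j < a)%N -> ~~ has_el S 0 || (t <= j)%N -> ~~ covered S j.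
    move=> ja j0; apply: uncovered_intro => e Se.
      move=> ej; have [e0|/(elN _ Se)] := posnP e; last by rewrite leqNgt (leq_ltn_trans ej).
      by move: j0; rewrite e0 in Se *; rewrite Se.
    by move=> je; have := low e Se (leq_ltn_trans (leq0n _) je); clear; lia.
  rewrite un_sum el_sum; have [S0|S0] := boolP (has_el S 0).
    (* 0 starts a block of its own, which first_el S may cut short *)
    have [ta|at_] := leqP a t.
      right; exists r, a; have -> : el 0 = 1%N by rewrite /el S0.
      by rewrite a_gt0 ta; split=> //; move: iE N U; clear; lia.
    have un0 := @un_count t (ltnW at_) (fun j ja => un_low j (proj2 (andP ja))
      (introT orP (or_intror (proj1 (andP ja))))).
    left; exists r.+1; have -> : el 0 = 1%N by rewrite /el S0.
    by split; move: iE N U at_ un0; clear; lia.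
  have un0 := @un_count 0 (leq0n _) (fun j ja => un_low j (proj2 (andP ja))
      (introT orP (or_introl S0))).
  left; exists r; have -> : el 0 = 0%N by rewrite /el (negPf S0).
  by split; move: iE N U un0; clear; lia.
have [Si|SiN] := boolP (has_el S i); last first.
  have uni := uncovered_out ai fi SiN ltik.
  apply: (IH i.+1 r nb.+1); first by clear -ltm ltik; lia.
  - by rewrite ltik (leq_trans ai).
  - by rewrite next_freeS /block_start (negPf SiN) andbF (leq_trans fi).
  - by rewrite iE addnS.
  - by rewrite big_nat_recr //= {2}/el (negPf SiN) addn0.
  - rewrite !big_nat_recr //= {2}/el {2}/un (negPf SiN) uni.
    by move: U; clear; lia.
have bi : block_start S i by rewrite /block_start fi Si.
have i_gt0 := block_start_gt0 bi.
have [fit|nofit] := ltnP (i + t)%N k.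
  have [w1 w2] := block_weight bi fit.
  apply: (IH (i + t).+1 r.+1 nb); first by clear -ltm ltik; lia.
  - by rewrite fit; clear -ai; lia.
  - by rewrite (next_free_block bi) ?leqnn // ltnS leq_addr.
  - by rewrite iE; clear; lia.
  - by rewrite (big_cat_nat (n := i)) //=; [move: N w1 | ]; clear; lia.
  - have ii : (i <= (i + t).+1)%N by clear; lia.
    rewrite !(big_cat_nat (n := i) ai ii) /=.
    by move: U w2; clear; lia.
(* the block of i is cut by the end of the cycle *)
have high := critical_high Si i_gt0.
have elk : (\sum_(a <= j < k) el j = \sum_(a <= j < i) el j + 1 + el i.+1)%N.
  rewrite (big_cat_nat (n := i)) //= -addnA; congr (_ + _)%N.
  rewrite big_ltn // {1}/el Si; congr (_ + _)%N.
  have [ik1|ki1] := ltnP i.+1 k.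
    by rewrite big_ltn // block_elements ?addn0 //; clear -nofit; lia.
  rewrite big_geq // /el; case: (boolP (has_el _ _)) => // /has_el_lt.
  by rewrite ltnNge ki1.
have unk : (\sum_(a <= j < i) un j <= \sum_(a <= j < k) un j)%N.
  by rewrite [leqRHS](big_cat_nat (n := i)) //= leq_addr.
have last_el e : has_el S e -> (e <= i + el i.+1)%N.
  move=> Se; have [ei|ei] := leqP e i; first by rewrite (leq_trans ei) ?leq_addr.
  have [ei1|ei1] := eqVneq e i.+1; first by rewrite -ei1 /el Se ei1 addn1.
  have := @critical_gap i e bi; rewrite Se ltn_neqAle eq_sym ei1 ei /=.
  by rewrite (leq_trans (ltnW (has_el_lt Se)) nofit) => /(_ isT).
left; exists r.+1; rewrite un_sum el_sum elk.
have [S0|S0] := boolP (has_el S 0); last first.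
  have hi1 : (i + el i.+1 + t < k + a)%N.
    rewrite /el; case: (boolP (has_el S i.+1)) => [Si1|_]; last by rewrite addn0.
    by rewrite addn1; apply: critical_high.
  pose q := (i + el i.+1 + t - k)%N.
  have qa : (q <= a)%N by rewrite /q; move: hi1; clear; lia.
  have un0 : (a - q <= \sum_(0 <= j < a) un j)%N.
    apply: un_count => // j /andP[qj ja]; apply: uncovered_intro => e Se.
      move=> ej; have [e0|/(elN _ Se)] := posnP e; last by rewrite leqNgt (leq_ltn_trans ej).
      by rewrite e0 (negPf S0) in Se.
    move=> je; have := last_el e Se; move: qj; rewrite /q; clear; lia.
  have -> : el 0 = 0%N by rewrite /el (negPf S0).
  have el1 : (el i.+1 <= 1)%N by rewrite /el; case: (has_el _ _).
  by split; move: iE N U hi1 un0 unk el1 nofit; rewrite /q; clear; lia.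
have -> : el 0 = 1%N by rewrite /el S0.
have [ik1|ki1] := leqP i.+2 k.
  have ti : (k + a <= i.+1 + t)%N.
    rewrite leqNgt; apply/negP => /(critical_block bi)/negP; apply.
    by apply/hitsP; right; rewrite ik1.
  have -> : el i.+1 = 0%N.
    rewrite /el; case: (boolP (has_el S i.+1)) => // /critical_high/(_ (ltn0Sn _)).
    by rewrite ltnNge ti.
  by split; move: iE N U high ti unk; clear; lia.
have -> : el i.+1 = 0%N.
  rewrite /el; case: (boolP (has_el S i.+1)) => // /has_el_lt.
  by rewrite ltnNge -ltnS ki1.
have ta : (t <= a)%N by move: high ki1; clear; lia.
have un0 : (a - t <= \sum_(0 <= j < a) un j)%N.
  apply: un_count => // j /andP[tj ja]; apply: uncovered_intro => e Se.
    move=> ej; have [->//|/(elN _ Se)] := posnP e.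
    by rewrite leqNgt (leq_ltn_trans ej).
  by move=> je; have := has_el_lt Se; move: tj; clear; lia.
by split; move: iE N U high ki1 ltik unk un0 ta; clear; lia.
Qed.

Lemma critical_block_count :
  block_count #|S| (#|S| + #|[set j : 'I_k | ~~ covered S j]|).
Proof.
apply: (@scan_blocks a 0 0); rewrite ?leqnn ?a_le //.
- case: (next_free_spec S a) => [[-> _] //|[c [ca bc _ _]]].
  have [_ Sc] := andP bc.
  by have := first_el_ge Sc (block_start_gt0 bc); rewrite leqNgt ca.
- by rewrite muln0 !addn0.
- by rewrite big_geq.
Qed.

End CriticalSet.

(** The projective dimension for [k = p * (t + 1) + d]. *)
Definition top_degree p d : nat := if d == 0%N then (2 * p)%N else (2 * p + 1)%N.

(** [r <= p] blocks fit into the cycle.  In the second outcome [r = p] forces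
    [d >= b > 0], so that the extra element is accounted for. *)
Lemma block_count_bounds p d N X : k = (p * (t + 1) + d)%N -> (d <= t)%N ->
  block_count N X -> (N <= top_degree p d <= X)%N.
Proof.
move=> kE dt; have rp r b : (t.+1 * r + b <= k)%N -> (r <= p)%N.
  move=> le; rewrite leqNgt; apply/negP => pr.
  have : (t.+1 * p.+1 <= t.+1 * r)%N by rewrite leq_mul2l pr orbT.
  by move: le dt; rewrite kE; clear; lia.
case=> [[r [le1 le2 le3]]|[r [b [/andP[b0 bt] le1 le2 le3]]]].
  have lerp : (r <= p)%N by apply: (rp r 0%N); rewrite addn0.
  have le4 : (t.-1 * r <= t.-1 * p)%N by rewrite leq_mul2l lerp orbT.
  have tE : t = t.-1.+1 by rewrite prednK.
  rewrite /top_degree; move: le2 le3 le4 lerp kE; rewrite tE /=; move: t.-1 => t'.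
  by clear; case: eqP; lia.
have lerp := rp r b le1.
have [rE|rN] := eqVneq r p.
  subst r; have d0 : (b <= d)%N by move: le1; rewrite kE; clear; lia.
  rewrite /top_degree; have -> : (d == 0)%N = false by move: d0 b0; clear; lia.
  by apply/andP; split; move: d0 le2 le3 kE; clear; lia.
have [x pE] : exists x, p = (r + x.+1)%N by exists (p - r.+1)%N; move: lerp rN; clear; lia.
have top_le : (top_degree p d <= 2 * p + d)%N by rewrite /top_degree; case: eqP; clear; lia.
have le_top : (2 * p <= top_degree p d)%N by rewrite /top_degree; case: eqP; clear; lia.
apply/andP; split; first by apply: leq_trans le_top; rewrite pE; move: le2; clear; lia.
apply: leq_trans top_le _; have x2 : (2 * x <= t.+1 * x)%N by rewrite leq_mul2r ltnS t_gt0 orbT.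
by move: le3 x2 bt; rewrite kE pE; clear; lia.
Qed.

Lemma critical_bounds S p d : (0 < k)%N -> k = (p * (t + 1) + d)%N -> (d <= t)%N ->
    critical S ->
  (#|S| <= top_degree p d <=
    #|S| + #|[set j : 'I_k | ~~ covered S j]|)%N.
Proof.
by move=> k0 kE dt critS; apply: block_count_bounds (critical_block_count _ _).
Qed.

End CyclicMatching.

(** * The extremal critical set and the geometry of the facets *)

Section TopSet.
Variables (k t p d : nat).
Hypothesis t_gt0 : (0 < t)%N.
Hypothesis k_gt0 : (0 < k)%N.
Hypothesis kE : k = (p * (t + 1) + d)%N.
Hypothesis d_le_t : (d <= t)%N.

Let e := if d == 0%N then t else d.

(** Position [0] followed by blocks of length [t + 1] with two elements each.  With
    the offset [d] the blocks end exactly where the cycle closes; for [d = 0] the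
    offset is [t], and the last block is cut after its first element. *)
Definition top_set : {set 'I_k} :=
  [set x : 'I_k | (x == 0 :> nat) || (e <= x)%N && ((x - e) %% t.+1 < 2)%N].

Let top_elP i : has_el top_set i =
  (i < k)%N && ((i == 0%N) || (e <= i)%N && ((i - e) %% t.+1 < 2)%N).
Proof.
have [ik|ki] := ltnP i k.
  by rewrite (_ : i = Ordinal ik) // has_elP inE.
by apply: contraFF (leq_gtF ki) => /has_el_lt.
Qed.

Let e_gt0 : (0 < e)%N. Proof. by rewrite /e; case: eqP => //; lia. Qed.
Let e_le_t : (e <= t)%N. Proof. by rewrite /e; case: eqP. Qed.
Let e_le_k : (e <= k)%N.
Proof.
rewrite /e; case: eqP => [d0|_]; last by rewrite kE leq_addl.
by move: kE k_gt0; case: p => [|p']; rewrite d0; [|clear]; lia.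
Qed.

Let kE' : (k = e + t.+1 * p \/ e = t /\ k = t.+1 * p)%N.
Proof. by rewrite /e; case: eqP => [d0|_]; [right | left]; move: kE; lia. Qed.

Let el_step j : (e + t.+1 * j < k)%N -> has_el top_set (e + t.+1 * j).
Proof. by move=> lt; rewrite top_elP lt leq_addr addKn modnMr orbT. Qed.

Let el_ge i : has_el top_set i -> (0 < i)%N -> (e <= i)%N.
Proof. by rewrite top_elP lt0n => /andP[_] /orP[/eqP->|/andP[]]. Qed.

Let first_top : first_el top_set = e.
Proof.
have [ek|ke] := ltnP e k.
  apply: first_el_unique => // [|i i0 /el_ge]; last exact.
  by have := @el_step 0; rewrite muln0 addn0; apply.
apply/eqP; rewrite eqn_leq (leq_trans (first_el_le _ k_gt0)) //=.
have [lt|] := ltnP (first_el top_set) k; last exact: leq_trans.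
exact: el_ge (first_el_has lt) (ltn0Sn _).
Qed.

(** The blocks of the scan are the ones put in by construction. *)
Let top_start c : block_start t top_set c -> exists j, c = (e + t.+1 * j)%N.
Proof.
have [N] := ubnP c; elim: N c => // N IH c ltc bc; have [fc Sc] := andP bc.
have c0 := block_start_gt0 bc; have ec := el_ge Sc c0; have ck := has_el_lt Sc.
case: (next_free_spec t top_set c) => [[_ H]|[c' [c'c bc' nf H]]].
  exists 0%N; rewrite muln0 addn0; apply/eqP; rewrite eqn_leq ec andbT leqNgt.
  apply/negP => lt; have := H e; rewrite e_gt0 lt => /(_ isT)/negP; apply.
  by have := @el_step 0; rewrite muln0 addn0; apply; apply: ltn_trans lt ck.
have [|j c'E] := IH c' _ bc'; first by apply: leq_trans c'c _.
exists j.+1; rewrite nf in fc; apply/eqP; rewrite eqn_leq.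
have stepE : (e + t.+1 * j.+1 = (c' + t).+1)%N by rewrite c'E; lia.
rewrite stepE fc andbT leqNgt; apply/negP => lt.
have := H (c' + t).+1; rewrite ltnSn lt => /(_ isT)/negP; apply.
by rewrite -stepE; apply: el_step; rewrite stepE (ltn_trans lt).
Qed.

Lemma top_set_critical : critical t top_set.
Proof.
split=> [|c].
  apply/zero_freeP => i Si i0; rewrite first_top; have ik := has_el_lt Si.
  case: kE' => [kE1|[-> _]]; last by rewrite ltn_add2r.
  move: Si; rewrite top_elP ik -[i == 0%N]negbK -lt0n i0 /= => /andP[ei].
  have := divn_eq (i - e) t.+1; move: (_ %/ _)%N (_ %% _)%N => q r iE r2.
  have qp : (q < p)%N.
    have : (q * t.+1 < p * t.+1)%N by move: iE kE1 ik ei; clear; lia.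
    by rewrite ltn_mul2r => /andP[].
  have : (q.+1 * t.+1 <= p * t.+1)%N by rewrite leq_mul2r qp orbT.
  by move: iE kE1 ei r2 e_gt0; clear; lia.
apply/negP => /and3P[bc ct /hitsP]; have [j cE] := top_start bc.
rewrite first_top in ct; case=> [[i Si /andP[ci ic]]|[_ /andP[ck kc]]].
  move: Si; rewrite top_elP => /andP[_ /orP[/eqP i0|/andP[ei]]].
    by rewrite i0 in ci.
  have -> : (i - e = t.+1 * j + (i - c))%N by move: ci cE; clear; lia.
  rewrite mulnC modnMDl modn_small; move: ci ic; clear; lia.
have [pj|jp] := leqP p j.
  have : (t.+1 * p <= t.+1 * j)%N by rewrite leq_mul2l pj orbT.
  by case: kE' ck cE e_gt0 => [|[]]; clear; lia.
have le : (t.+1 * j.+1 <= t.+1 * p)%N by rewrite leq_mul2l jp orbT.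
case: kE' => [kE1|[et kE1]]; first by move: kE1 le cE kc; clear; lia.
have [pj1|jp1] := leqP p j.+1.
  have pE : p = j.+1 by apply/eqP; rewrite eqn_leq pj1.
  by move: kE1 cE et ck; rewrite pE; clear; lia.
have : (t.+1 * j.+2 <= t.+1 * p)%N by rewrite leq_mul2l jp1 orbT.
by move: kE1 cE et kc; clear; lia.
Qed.

Lemma top_set_covered (j : 'I_k) : covered t top_set j.
Proof.
apply/coveredP; have [je|ej] := ltnP j e.
  exists 0%N; first by rewrite top_elP k_gt0.
  by rewrite /covers leq0n subn0 (leq_trans je).
have := divn_eq (j - e) t.+1; have := ltn_pmod (j - e) (ltn0Sn t).
move: (_ %/ _)%N (_ %% _)%N => q r rt jE; have jk := ltn_ord j.
have [rlt|rge] := ltnP r t.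
  exists (e + t.+1 * q)%N; first by apply: el_step; move: jE jk ej; clear; lia.
  rewrite /covers; have -> : (e + t.+1 * q <= j)%N by move: jE jk ej; clear; lia.
  by move: jE ej rlt; clear; lia.
exists (e + t.+1 * q).+1.
  have lt : ((e + t.+1 * q).+1 < k)%N by move: jE jk ej rge t_gt0; clear; lia.
  rewrite top_elP lt (_ : _ - e = q * t.+1 + 1)%N; last by clear; lia.
  by rewrite modnMDl modn_small //= -addnS leq_addr.
rewrite /covers; have -> : ((e + t.+1 * q).+1 <= j)%N.
  by move: jE jk ej rge t_gt0; clear; lia.
by move: jE ej rt rge t_gt0; clear; lia.
Qed.

End TopSet.

Section CycleFacets.
Variables (n m l k t s : nat).
Hypothesis l_gt0 : (0 < l)%N.
Hypothesis nE : n = (k * l)%N.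
Hypothesis mE : m = (t * l + s)%N.
Hypothesis s_lt_l : (s < l)%N.
Hypothesis m_le_n : (m <= n)%N.
Hypothesis t_gt0 : (0 < t)%N.
Implicit Types (S : {set 'I_k}) (v : 'I_n).

Definition cycle_facet (i : 'I_k) : {set 'I_n} := path_facet n m l i.

Lemma mem_path_facet v i : (i < k)%N -> (v \in path_facet n m l i) =
  if (i * l <= v)%N then (v - i * l < m)%N else (v + n - i * l < m)%N.
Proof.
move=> ik; have il : (i * l < n)%N by rewrite nE ltn_mul2r l_gt0.
have vn := ltn_ord v; rewrite inE; apply/existsP/idP => [[j /eqP vE]|].
  have jm := ltn_ord j; have [lt|ge] := ltnP (i * l + j)%N n.
    rewrite modn_small // in vE; rewrite vE leq_addr.
    by move: jm; clear; lia.
  have vE' : nat_of_ord v = (i * l + j - n)%N.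
    rewrite vE -[in LHS](subnK ge) modnDr modn_small //.
    by move: jm il m_le_n; clear; lia.
  have -> : (i * l <= v)%N = false by move: jm il vE' m_le_n ge; clear; lia.
  by move: vE' jm ge il; clear; lia.
case: (leqP (i * l) v) => cmp lt.
  by exists (Ordinal lt); rewrite /= subnKC // modn_small.
exists (Ordinal lt); rewrite /=.
have -> : (i * l + (v + n - i * l) = v + n)%N by move: cmp il; clear; lia.
by rewrite modnDr modn_small.
Qed.

Let tl_le_m : (t * l <= m)%N. Proof. by rewrite mE leq_addr. Qed.

Lemma last_vertex_lt (j : 'I_k) : (j * l + l.-1 < n)%N.
Proof.
have : (j.+1 * l <= k * l)%N by rewrite leq_mul2r ltn_ord orbT.
by move: l_gt0; rewrite nE; clear; lia.
Qed.

(** The vertices are grouped into [k] blocks of length [l].  As [s < l], the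
    remainder [s] of a facet never reaches the last vertex of a block, which
    therefore detects the [t] full blocks of the facet. *)
Definition last_vertex j : 'I_n := Ordinal (last_vertex_lt j).

Lemma last_vertexP S j : (last_vertex j \in facet_union cycle_facet S) = covered t S j.
Proof.
have facetP (i : 'I_k) : (last_vertex j \in cycle_facet i) = covers k t i j.
  rewrite mem_path_facet //= /covers.
  have [ij|ji] := leqP i j.
    have [x jE] : exists x, nat_of_ord j = (i + x)%N by exists (j - i)%N; rewrite subnKC.
    have -> : (i * l <= j * l + l.-1)%N by rewrite jE mulnDl -addnA leq_addr.
    rewrite jE addKn mulnDl -addnA addKn mE.
    have [xt|tx] := ltnP x t.
      have : (x.+1 * l <= t * l)%N by rewrite leq_mul2r xt orbT.
      by move: l_gt0; clear; lia.
    have : (t * l <= x * l)%N by rewrite leq_mul2r tx orbT.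
    by move: s_lt_l; clear; lia.
  have [x xE] : exists x, (j + k = i + x)%N.
    by exists (j + k - i)%N; rewrite subnKC //; have := ltn_ord i; clear; lia.
  have le : (j.+1 * l <= i * l)%N by rewrite leq_mul2r ji orbT.
  have -> : (i * l <= j * l + l.-1)%N = false by move: le l_gt0; clear; lia.
  rewrite xE addKn; have -> : (j * l + l.-1 + n - i * l = x * l + l.-1)%N.
    have : (j * l + n = i * l + x * l)%N by rewrite nE -!mulnDl xE.
    by clear; lia.
  rewrite mE; have [xt|tx] := ltnP x t.
    have : (x.+1 * l <= t * l)%N by rewrite leq_mul2r xt orbT.
    by move: l_gt0; clear; lia.
  have : (t * l <= x * l)%N by rewrite leq_mul2r tx orbT.
  by move: s_lt_l; clear; lia.
by apply/bigcupP/exists_inP => -[i iS]; rewrite ?facetP => h; exists i; rewrite ?facetP.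
Qed.

Lemma card_uncovered S :
  (#|facet_union cycle_facet S| + #|[set j : 'I_k | ~~ covered t S j]| <= n)%N.
Proof.
have inj : injective last_vertex.
  move=> i j /(congr1 val) /= /addIn /eqP; rewrite eqn_mul2r.
  by rewrite [l == 0%N]eqn0Ngt l_gt0 => /eqP/val_inj.
rewrite -(card_imset _ inj) -[leqRHS]card_ord.
rewrite -(cardsC (facet_union cycle_facet S)) leq_add2l.
apply/subset_leq_card/subsetP => v /imsetP[j]; rewrite inE => Sj ->.
by rewrite inE last_vertexP.
Qed.

Lemma facet_union_full S : (forall j : 'I_k, covered t S j) ->
  facet_union cycle_facet S = [set: 'I_n].
Proof.
move=> covS; apply/setP => v; rewrite inE; apply/bigcupP.
have vk : (v %/ l < k)%N by rewrite ltn_divLR // -nE.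
have /exists_inP[i iS cov] := covS (Ordinal vk); exists i => //.
rewrite mem_path_facet //.
have := divn_eq v l; have := ltn_pmod v l_gt0.
move: cov; rewrite /covers /= {vk}; move: (_ %/ _)%N (_ %% _)%N => q r.
case: (leqP i q) => [iq|qi] lt rl vE.
  have [x qE] : exists x, q = (i + x)%N by exists (q - i)%N; rewrite subnKC.
  rewrite qE addKn in lt; rewrite vE qE mulnDl -addnA leq_addr addKn.
  have : (x.+1 * l <= t * l)%N by rewrite leq_mul2r lt orbT.
  by move: rl tl_le_m; clear; lia.
have le : (q.+1 * l <= i * l)%N by rewrite leq_mul2r qi orbT.
have -> : (i * l <= v)%N = false by move: le vE rl; clear; lia.
have [x xE] : exists x, (q + k = i + x)%N.
  by exists (q + k - i)%N; rewrite subnKC //; have := ltn_ord i; clear; lia.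
rewrite xE addKn in lt.
have : (q * l + n = i * l + x * l)%N by rewrite nE -!mulnDl xE.
have : (x.+1 * l <= t * l)%N by rewrite leq_mul2r lt orbT.
by rewrite vE; move: rl tl_le_m; clear; lia.
Qed.

(** The facet of the pivot lies in the union of the facets of its two neighbours,
    which are at distance at most [t] and therefore overlap or touch. *)
Lemma facet_between S (q : 'I_k) : (pivot t S < k)%N -> q = pivot t S :> nat ->
  cycle_facet q \subset facet_union cycle_facet (S :\ q).
Proof.
move=> pk qE.
have memU v i : has_el S i -> i != q -> (v \in path_facet n m l i) ->
    v \in facet_union cycle_facet (S :\ q).
  case/has_el_ex => x xS -> xq vx; apply/bigcupP; exists x => //.
  by rewrite !inE xS andbT.
have facetP v i : has_el S i -> _ := fun Si => @mem_path_facet v i (has_el_lt Si).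
apply/subsetP => v; rewrite mem_path_facet // => vq; have vn := ltn_ord v.
have [zS|zSN] := boolP (zero_free t S); last first.
  have q0 : q = 0%N :> nat by rewrite qE /pivot (negPf zSN).
  rewrite q0 mul0n leq0n subn0 in vq.
  move: zSN; rewrite negb_forall_in => /exists_inP[b bS]; rewrite negb_imply -leqNgt.
  case/andP => b0 bt; have Sb : has_el S b by rewrite has_elP.
  pose a := first_el S; have ab : (a <= b)%N by apply: first_el_ge.
  have Sa : has_el S a by apply: first_el_has; apply: leq_ltn_trans ab (ltn_ord b).
  have [av|va] := leqP (a * l) v.
    apply: (memU v a) => //; first by rewrite q0.
    by rewrite facetP // av (leq_ltn_trans (leq_subr _ _)).
  apply: (memU v b) => //; first by rewrite q0 -lt0n.
  rewrite facetP //; case: (leqP (b * l) v) => vb; first by rewrite (leq_ltn_trans (leq_subr _ _)).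
  have : ((k + a) * l <= (b + t) * l)%N by rewrite leq_mul2r bt orbT.
  have bn : (b * l <= n)%N by rewrite nE leq_mul2r (ltnW (ltn_ord b)) orbT.
  by rewrite !mulnDl -nE; move: va tl_le_m vb bn; clear; lia.
have [c [pE /and3P[bc _ hc] _]] := pivotP pk zS; have [_ Sc] := andP bc.
rewrite pE in qE; have cq : c != q by rewrite qE neq_ltn ltnSn.
have qlE : (q * l = c * l + l)%N by rewrite qE mulSn addnC.
case/hitsP: hc => [[e Se /andP[ce et]]|[S0 /andP[ck kt]]].
  have eq : e != q by rewrite qE neq_ltn ce orbT.
  have le1 : (c.+2 * l <= e * l)%N by rewrite leq_mul2r ce orbT.
  have le2 : (e * l <= (c + t) * l)%N by rewrite leq_mul2r et orbT.
  have ele : (e * l <= n)%N by rewrite nE leq_mul2r (ltnW (has_el_lt Se)) orbT.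
  have [ev|ve] := leqP (e * l) v.
    apply: (memU v e) => //; rewrite facetP // ev.
    have qv : (q * l <= v)%N by move: le1 ev qlE; clear; lia.
    by rewrite qv in vq; move: vq le1 qlE; clear; lia.
  case: (leqP (q * l) v) vq => [qv|vq'] vq.
    apply: (memU v c) => //; rewrite facetP //.
    have -> : (c * l <= v)%N by move: qv qlE; clear; lia.
    by move: ve le2 tl_le_m l_gt0 qv qlE; rewrite mulnDl; clear; lia.
  apply: (memU v e) => //; rewrite facetP // leqNgt ve /=.
  by move: vq vq' qlE le1 ele vn; clear; lia.
have q0 : (0%N : nat) != q by rewrite qE.
have kle : (n <= c * l + t * l)%N by rewrite nE -mulnDl leq_mul2r kt orbT.
have [vm|mv] := ltnP v m.
  by apply: (memU v 0%N) => //; rewrite facetP // mul0n leq0n subn0.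
case: (leqP (q * l) v) vq => [qv|vq'] vq.
  apply: (memU v c) => //; rewrite facetP //.
  have -> : (c * l <= v)%N by move: qv qlE; clear; lia.
  by move: vn kle tl_le_m qv qlE; clear; lia.
have qn : (q * l <= n)%N by rewrite nE leq_mul2r (ltnW (ltn_ord q)) orbT.
by move: mv vq vq' qn; clear; lia.
Qed.

End CycleFacets.

(** * The critical cells of the path ideal *)

Lemma lex_lt (N a b c a' b' c' : nat) : (b <= N)%N -> (c <= N)%N ->
  (a < a')%N \/ a = a' /\ ((b < b')%N \/ b = b' /\ (c < c')%N) ->
  ((a * N.+1 + b) * N.+1 + c < (a' * N.+1 + b') * N.+1 + c')%N.
Proof.
move=> bN cN; case=> [aa|[-> [bb|[-> cc]]]]; last by rewrite ltn_add2l.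
  have h1 : (a.+1 * N.+1 <= a' * N.+1)%N by rewrite leq_mul2r aa orbT.
  have h2 : ((a * N.+1 + b).+1 * N.+1 <= (a' * N.+1 + b') * N.+1)%N.
    by rewrite leq_mul2r; apply/orP; right; move: h1 bN; clear; lia.
  by move: h2 cN; clear; lia.
have h2 : ((a' * N.+1 + b).+1 * N.+1 <= (a' * N.+1 + b') * N.+1)%N.
  by rewrite leq_mul2r; apply/orP; right; move: bb; clear; lia.
by move: h2 cN; clear; lia.
Qed.

Section CriticalCells.
Variables (K : fieldType) (n m l k t s : nat).
Hypothesis l_gt0 : (0 < l)%N.
Hypothesis nE : n = (k * l)%N.
Hypothesis mE : m = (t * l + s)%N.
Hypothesis s_lt_l : (s < l)%N.
Hypothesis m_le_n : (m <= n)%N.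
Hypothesis t_gt0 : (0 < t)%N.
Hypothesis k_gt0 : (0 < k)%N.
Implicit Types (S u b : {set 'I_k}) (q : 'I_k).

Let F := @cycle_facet n m l k.
Let L := facet_union F.
Let good (W : {set 'I_n}) := exists i, F i \subset W.
Let exact_on A c := @multigraded_exact K _ n (fun S => #|S|) L good A c.

Let toggle_el q S S' : q |: S = q |: S' ->
  forall i : nat, i != q -> has_el S' i = has_el S i.
Proof. by move=> E i /negPf iq; have := has_elU S' q i; rewrite -E has_elU iq. Qed.

Let is_upper S : bool := (pivot t S < k)%N && has_el S (pivot t S).

Let upper_cells := [set S | is_upper S].

Let mate S : {set 'I_k} := [set x in S | (x : nat) != pivot t S].

Let upperP S : S \in upper_cells -> exists q,
  [/\ q = pivot t S :> nat, q \in S, mate S = S :\ q & pivot t (mate S) = pivot t S].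
Proof.
rewrite inE => /andP[pk /has_el_ex[q qS pE]].
have mE' : mate S = S :\ q by apply/setP => x; rewrite !inE pE andbC.
exists q; split=> //; apply: (pivot_toggle pk); rewrite pE; apply: toggle_el.
by rewrite mE' setD1K //; apply/setUidPr; rewrite sub1set.
Qed.

Let upper_L S : S \in upper_cells -> L (mate S) = L S.
Proof.
move=> US; have [q [qE qS mS _]] := upperP US.
have pk : (pivot t S < k)%N by rewrite -qE.
rewrite mS -[in RHS](setD1K qS) /L facet_unionU1; apply/esym/setUidPr.
exact: (facet_between l_gt0 nE mE m_le_n pk qE).
Qed.

(** Lexicographic order on (number of vertices missed, [scan_origin], [pivot]): an
    upper cell with a larger multidegree comes first. *)
Let rank S : nat := ((n - #|L S|) * k.+1 + scan_origin t S) * k.+1 + pivot t S.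

Let scan_origin_le S : (scan_origin t S <= k)%N.
Proof. by rewrite /scan_origin; case: ifP => // _; apply: first_el_le. Qed.

Let rank_decrease u u' : u \in upper_cells -> u' \in upper_cells -> u' != u ->
  taylor_coef K u' (mate u) != 0 -> (rank u' < rank u)%N.
Proof.
move=> Uu Uu' neq /taylor_coef_neq0[q qb u'E].
have [q0 [q0E q0u mu pm]] := upperP Uu.
move: Uu'; rewrite inE => /andP[pk' el'].
have pk : (pivot t u < k)%N by rewrite -q0E.
have qp : (q : nat) != pivot t (mate u).
  apply: contraNneq neq; rewrite pm -q0E => /val_inj qq0.
  by rewrite u'E qq0 mu setD1K.
have agree : forall i, i != pivot t u -> has_el (mate u) i = has_el u i.
  rewrite -q0E; apply: toggle_el; rewrite mu setD1K //.
  by apply/setUidPr; rewrite sub1set.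
have so := toggle_origin pk agree.
have elN : ~~ has_el (mate u) (pivot t (mate u)).
  by rewrite pm -q0E has_elP mu !inE eqxx.
have Lu' : L u \subset L u' by rewrite -(upper_L Uu) u'E /L facet_unionU1 subsetUr.
apply: lex_lt; first exact: scan_origin_le; first exact: ltnW.
have [Leq|Lneq] := eqVneq (L u') (L u); last first.
  left; have Llt : (#|L u| < #|L u'|)%N.
    by apply: proper_card; rewrite properEneq eq_sym Lneq.
  have : (#|L u'| <= n)%N by rewrite -[X in (_ <= X)%N](card_ord n) max_card.
  by move: Llt; clear; lia.
right; rewrite Leq; split=> //.
have covq : covered t (mate u) q.
  rewrite -(last_vertexP l_gt0 nE mE s_lt_l m_le_n) -/L (upper_L Uu) -Leq.
  rewrite u'E /L facet_unionU1 inE; apply/orP; left.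
  have := last_vertexP l_gt0 nE mE s_lt_l m_le_n [set q] q.
  rewrite /facet_union big_set1 => ->; apply/exists_inP; exists q; rewrite ?set11 //.
  by rewrite /covers leqnn subnn.
rewrite -so -pm u'E.
by apply: pivot_decrease; rewrite -?u'E // pm.
Qed.

(** The Taylor complex reduces to the critical cells. *)
Lemma critical_cells_exact : exists A c,
  [/\ exact_on A c, forall S, S \in A -> critical t S
    & forall S, critical t S -> S \in A].
Proof.
have mate_inj : {in upper_cells &, injective mate}.
  move=> u u' Uu Uu' E; have [q [qE qu mu pm]] := upperP Uu.
  have [q' [qE' qu' mu' pm']] := upperP Uu'.
  have qq : q = q' by apply: val_inj; rewrite /= qE qE' -pm -pm' E.
  by rewrite -(setD1K qu) -(setD1K qu') -mu -mu' E qq.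
have [||c cA] := cancel_matching (rank := rank) (taylor_exact K F) mate_inj.
- move=> u Uu; have [q [qE qu mu pm]] := upperP Uu; split.
  + by rewrite inE /is_upper pm -qE has_elP mu !inE eqxx andbF.
  + exact: upper_L.
  + rewrite mu -{1}(setD1K qu) taylor_coef_insert ?signr_eq0 //.
    by rewrite !inE eqxx.
- exact: rank_decrease.
exists ([set: {set 'I_k}] :\: (upper_cells :|: mate @: upper_cells)), c.
split=> // S.
  rewrite !inE andbT negb_or => /andP[SN mSN]; apply: pivot_critical => //.
  apply/negP => pk; have pN : ~~ has_el S (pivot t S).
    by move: SN; rewrite /is_upper pk.
  pose q := Ordinal pk; have qS : q \notin S by rewrite -has_elP.
  have pq : pivot t (q |: S) = pivot t S.
    by apply: (pivot_toggle pk); apply: (@toggle_el q); rewrite setUA setUid.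
  case/negP: mSN; apply/imsetP; exists (q |: S).
    by rewrite inE /is_upper pq pk has_elU eqxx.
  apply/setP => x; rewrite !inE pq; have [->|xq] := eqVneq x q.
    by rewrite eqxx andbF (negPf qS).
  by rewrite /= andbC; case: eqP => // /(@val_inj _ _ _ x q)/eqP; rewrite (negPf xq).
move=> critS; rewrite !inE andbT negb_or; apply/andP; split.
  by rewrite /is_upper (negPf (critical_pivot critS)).
apply/imsetP => -[u Uu SE]; have [q [qE _ _ pm]] := upperP Uu.
by case/negP: (critical_pivot critS); rewrite SE pm -qE.
Qed.

End CriticalCells.

(** * Projective dimension and regularity *)

Theorem theorem1p7 (K : fieldType) (n m l s t k p d : nat)
    (l_gt0 : (0 < l)%N) (m_ge2 : (2 <= m)%N) (m_le_n : (m <= n)%N)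
    (l_dvd_n : (l %| n)%N) (l_le : (l <= minn (m - 1) (n %/ 2))%N)
    (m_mod : m = s %[mod l]) (s_lt_l : (s < l)%N)
    (t_def : t = ((m - s) %/ l)%N) (k_def : k = (n %/ l)%N)
    (k_eq : k = (p * (t + 1) + d)%N) (d_le_t : (d <= t)%N) :
  proj_dim_quot (@path_ideal K n m l)
    (if d == 0%N then 2 * p else 2 * p + 1)%N /\
  regularity_quot (@path_ideal K n m l)
    (if d == 0%N then n%:Z - (2 * p)%:Z else n%:Z - (2 * p)%:Z - 1).
Proof.
have nE : n = (k * l)%N by rewrite k_def divnK.
have mE : m = (t * l + s)%N.
  have sE : s = (m %% l)%N by rewrite m_mod modn_small.
  have -> : t = (m %/ l)%N by rewrite t_def sE {1}(divn_eq m l) addnK mulnK.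
  by rewrite sE -divn_eq.
have t_gt0 : (0 < t)%N.
  rewrite lt0n; apply/eqP => t0; move: l_le; rewrite leq_min => /andP[le _].
  by move: mE le s_lt_l m_ge2; rewrite t0; clear; lia.
have k_gt0 : (0 < k)%N.
  by rewrite lt0n; apply/eqP => k0; move: nE m_le_n m_ge2; rewrite k0; clear; lia.
pose L := facet_union (@cycle_facet n m l k).
pose top := top_degree p d.
have [A [c [cA Acrit critA]]] :=
  critical_cells_exact K l_gt0 nE mE s_lt_l m_le_n t_gt0 k_gt0.
have bounds S : S \in A -> (#|S| <= top)%N /\ (#|L S| + top <= n + #|S|)%N.
  move/Acrit => critS.
  have /andP[le1 le2] := critical_bounds t_gt0 k_gt0 k_eq d_le_t critS.
  split=> //; have := card_uncovered l_gt0 nE mE s_lt_l m_le_n S.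
  by move: le2; rewrite -/top -/L; clear; lia.
have [A' [c' [A'A c'A' c'min keep]]] := minimize cA.
pose S0 := top_set k t d.
have LS0 : L S0 = [set: 'I_n].
  apply: (facet_union_full l_gt0 nE mE m_le_n) => j.
  exact: top_set_covered t_gt0 k_gt0 d_le_t j.
have full_top S : S \in A -> L S = [set: 'I_n] -> #|S| = top.
  move=> /bounds[le1 le2] LS; apply/eqP; rewrite eqn_leq le1 /=.
  by move: le2; rewrite LS cardsT card_ord leq_add2l.
have S0A : S0 \in A.
  by apply: critA; apply: (top_set_critical t_gt0 k_gt0 k_eq d_le_t).
(* no cell of full multidegree has another size than S0, so S0 is never cancelled *)
have S0A' : S0 \in A'.
  by apply: keep => // y yA; rewrite -/L LS0 => Ly; rewrite !full_top.
have facet_neq0 (i : 'I_k) : cycle_facet n m l i != set0.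
  have n_gt0 : (0 < n)%N by apply: leq_trans m_le_n; apply: ltnW.
  have m_gt0 : (0 < m)%N by apply: ltnW.
  apply/set0Pn; exists (Ordinal (ltn_pmod (i * l + 0) n_gt0)).
  by rewrite inE; apply/existsP; exists (Ordinal m_gt0).
have L_eq0 S : L S = set0 -> S = set0.
  move=> LS; apply/eqP; rewrite -[_ == _]negbK; apply/set0Pn => -[i iS].
  by move: (facet_neq0 i); rewrite -subset0 -LS (bigcup_sup i).
have L0 : L set0 = set0 by rewrite /L /facet_union big_set0.
have el0 (i : nat) : has_el (set0 : {set 'I_k}) i = false.
  by apply/negbTE/negP => /has_el_ex[x]; rewrite inE.
have oA' : set0 \in A'.
  apply: keep => [|y _]; last by rewrite -/L L0 => /L_eq0->.
  apply: critA; split=> [|e].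
    by apply/zero_freeP => i; rewrite el0.
  by rewrite /switchable /block_start el0 andbF.
pose I := @path_ideal K n m l.
subst k.
have idealI : monomial_ideal I := @facet_ideal_monomial K n _ (@cycle_facet n m l (n %/ l)).
pose R := cell_resolution (fun S : {set 'I_(n %/ l)} => #|S|) L A' c'.
have resR : min_graded_free_resolution I R.
  apply: (cell_resolution_min c'A' oA' L0) => // S SA.
    by rewrite cards_eq0.
  rewrite card_gt0 => /set0Pn[i iS]; exists i; exact: (bigcup_sup i iS).
pose beta i j := #|[set S in A' | (#|S| == i) && (#|L S| == j)]|.
have betaP : graded_betti I beta.
  split=> [|G resG i j]; first by exists R.
  by rewrite -(betti_unique i j idealI resR resG) (cell_betti _ L).
have beta_neq0 i j : beta i j <> 0%N <->
    exists S, [/\ S \in A', #|S| = i & #|L S| = j].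
  rewrite /beta; split=> [/eqP|[S [SA Si Sj]]].
    rewrite -lt0n card_gt0 => /set0Pn[S]; rewrite inE => /and3P[SA /eqP Si /eqP Sj].
    by exists S.
  by apply/eqP; rewrite -lt0n card_gt0; apply/set0Pn; exists S; rewrite inE SA Si Sj !eqxx.
have topE : #|S0| = top by apply: full_top.
have topL : #|L S0| = n by rewrite LS0 cardsT card_ord.
have bounds' i j : beta i j <> 0%N -> (i <= top)%N /\ (j + top <= n + i)%N.
  by case/beta_neq0 => S [/(subsetP A'A)/bounds ? <- <-].
have beta_top : beta top n <> 0%N by apply/beta_neq0; exists S0.
split; exists beta => //; split.
- by exists n.
- by move=> i [j /bounds'[]].
- exists top, n; split=> //.
  by rewrite /top /top_degree; case: eqP => // _; lia.
- move=> r [i [j [/bounds'[_ le] ->]]].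
  by move: le; rewrite /top /top_degree; case: eqP => _; lia.
Qed.
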